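(* Let $\mu\in\mathbb{R}$, $\rho\in[-1,1]$ and $0<s<t\le T$. Let $(B^1,B^2)$ be a two-dimensional correlated Brownian motion with drift vector $(0,\mu)'$ and covariance matrix $\begin{pmatrix}1&\rho\\\rho&1\end{pmatrix}$, and let $M^2_{(s,t)}=\max_{s\le r\le t}B^2_r$. Let $F_{M^2_{(s,t)}}(\cdot;\mu)$ be the distribution function of $M^2_{(s,t)}$ and $\zeta(v)=F^{-1}_{M^2_{(s,t)}}(v;\mu)$. Then the copula $C_{B^1_T,M^2_{(s,t)}}(\cdot,\cdot;\mu,\rho)$ of the pair $(B^1_T,M^2_{(s,t)})$ is given, for $(u,v)\in(0,1)^2$, by $$\begin{aligned}C_{B^1_T,M^2_{(s,t)}}(u,v;\mu,\rho)={}&\Phi_3\left(\Phi^{-1}(u),\frac{\zeta(v)-\mu t}{\sqrt t},\frac{\zeta(v)-\mu s}{\sqrt s};\rho\sqrt{\frac tT},\rho\sqrt{\frac sT},\sqrt{\frac st}\right)\\&-e^{2\mu\zeta(v)}\,\Phi_3\left(\Phi^{-1}(u)-\frac{2\rho\zeta(v)}{\sqrt T},\frac{-\zeta(v)-\mu t}{\sqrt t},\frac{\zeta(v)+\mu s}{\sqrt s};\rho\sqrt{\frac tT},-\rho\sqrt{\frac sT},-\sqrt{\frac st}\right).\end{aligned}$$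
   Context: $\Phi$ denotes the standard normal distribution function, and $\Phi_3(z_1,z_2,z_3;\rho_{12},\rho_{13},\rho_{23})=\mathbb{P}\{Z_1\le z_1,Z_2\le z_2,Z_3\le z_3\}$ where $(Z_1,Z_2,Z_3)$ is a (possibly degenerate) trivariate normal vector with standard normal margins and correlations $\mathrm{corr}(Z_i,Z_j)=\rho_{ij}$. The two-dimensional Brownian motion $(B^1,B^2)$ with drift vector $(0,\mu)'$ and the given covariance matrix is constructed as $B^1_r=\rho W^2_r+\sqrt{1-\rho^2}\,W^1_r$ and $B^2_r=W^2_r+\mu r$ for $r\ge0$, where $W^1,W^2$ are independent standard Brownian motions started at $0$. For a distribution function $F$, $F^{-1}(u)=\inf\{x: F(x)\ge u\}$ for $u\in(0,1)$. For random variables $X_1,X_2$ with continuous distribution functions $F_1,F_2$ and joint distribution function $F$, the copula of $(X_1,X_2)$ is the unique function $C:[0,1]^2\to[0,1]$ that is a distribution function with uniform margins and satisfies $F(x_1,x_2)=C(F_1(x_1),F_2(x_2))$ for all $x_1,x_2$; equivalently $C(u_1,u_2)=F(F_1^{-1}(u_1),F_2^{-1}(u_2))$ for $(u_1,u_2)\in(0,1)^2$. *)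

(* Defs.v *)
From HB Require Import structures.
From mathcomp Require Import all_boot all_order all_algebra.
From mathcomp Require Import all_classical all_reals all_analysis.
From mathcomp Require Import ring lra.

Set Implicit Arguments.
Unset Strict Implicit.
Unset Printing Implicit Defensive.

Import Order.TTheory GRing.Theory Num.Theory.
Import numFieldNormedType.Exports.

Local Open Scope classical_set_scope.
Local Open Scope ring_scope.

Section distribution_functions.
Context d (Omega : measurableType d) (R : realType) (P : probability Omega R).

Definition distribution_function (X : Omega -> R) (x : R) : R :=
  fine (P [set w | X w <= x]).

Definition joint_distribution_function (X Y : Omega -> R) (x y : R) : R :=
  fine (P [set w | X w <= x /\ Y w <= y]).

End distribution_functions.

Definition quantile (R : realType) (F : R -> R) (u : R) : R :=
  inf [set x | u <= F x].

(* C is only constrained on the unit square; its values elsewhere are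
   irrelevant. *)
Definition is_copula (R : realType) (C : R -> R -> R) : Prop :=
  exists Q : probability (R * R)%type R,
    [/\ (forall A : set R, measurable A ->
           Q (fst @^-1` A) = uniform_prob (@ltr01 R) A),
        (forall A : set R, measurable A ->
           Q (snd @^-1` A) = uniform_prob (@ltr01 R) A) &
        forall u v : R, 0 <= u <= 1 -> 0 <= v <= 1 ->
          C u v = fine (Q [set x | x.1 <= u /\ x.2 <= v])].

Definition copula_of d (Omega : measurableType d) (R : realType)
    (P : probability Omega R) (X Y : Omega -> R) (C : R -> R -> R) : Prop :=
  is_copula C /\
  forall x y : R, joint_distribution_function P X Y x y =
    C (distribution_function P X x) (distribution_function P Y y).

Section normal_distribution_functions.
Context (R : realType).

Definition Phi (x : R) : R := fine (normal_prob (0 : R) 1 `]-oo, x]).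

(* Law of three independent standard normal variables. *)
Definition std_gauss3 : set (R * R * R) -> \bar R :=
  ((normal_prob (0 : R) 1 \x normal_prob (0 : R) 1)
     \x normal_prob (0 : R) 1)%E.

(* Cholesky factor L of the correlation matrix with off-diagonal entries
   r12, r13, r23. When r12 ^+ 2 = 1 the inverse of 0 is 0, so chol32 = 0, which
   is the correct entry of the factor of a singular matrix. *)
Definition chol22 (r12 : R) : R := Num.sqrt (1 - r12 ^+ 2).
Definition chol32 (r12 r13 r23 : R) : R := (r23 - r12 * r13) / chol22 r12.
Definition chol33 (r12 r13 r23 : R) : R :=
  Num.sqrt (1 - r13 ^+ 2 - chol32 r12 r13 r23 ^+ 2).

(* The vector Z = L g, for g distributed according to std_gauss3, is the
   trivariate normal vector with mean 0 and covariance matrix L L^T. *)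
Definition normal3 (r12 r13 r23 : R) (g : R * R * R) : R * R * R :=
  (g.1.1,
   r12 * g.1.1 + chol22 r12 * g.1.2,
   r13 * g.1.1 + chol32 r12 r13 r23 * g.1.2 + chol33 r12 r13 r23 * g.2).

Definition Phi3 (z1 z2 z3 r12 r13 r23 : R) : R :=
  fine (std_gauss3 [set g | let Z := normal3 r12 r13 r23 g in
                            [/\ Z.1.1 <= z1, Z.1.2 <= z2 & Z.2 <= z3]]).

(* L L^T is the prescribed correlation matrix as soon as the latter is positive
   semidefinite, possibly singular. *)
Lemma chol_correlation (r12 r13 r23 : R) :
  r12 ^+ 2 <= 1 -> r13 ^+ 2 <= 1 -> r23 ^+ 2 <= 1 ->
  0 <= 1 + 2 * r12 * r13 * r23 - r12 ^+ 2 - r13 ^+ 2 - r23 ^+ 2 ->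
  [/\ r12 ^+ 2 + chol22 r12 ^+ 2 = 1,
      r13 ^+ 2 + chol32 r12 r13 r23 ^+ 2 + chol33 r12 r13 r23 ^+ 2 = 1 &
      r12 * r13 + chol22 r12 * chol32 r12 r13 r23 = r23].
Proof.
move=> h12 h13 h23 hdet.
have a2 : chol22 r12 ^+ 2 = 1 - r12 ^+ 2 by rewrite /chol22 sqr_sqrtr; lra.
have [a0|a0] := eqVneq (chol22 r12) 0.
  have r12E : r12 ^+ 2 = 1 by move: a2; rewrite a0 expr0n/=; lra.
  have e : r23 - r12 * r13 = 0.
    apply/eqP; rewrite -sqrf_eq0 eq_le sqr_ge0 andbT.
    have -> : (r23 - r12 * r13) ^+ 2 =
      r23 ^+ 2 - 2 * r12 * r13 * r23 + r12 ^+ 2 * r13 ^+ 2 by ring.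
    by rewrite r12E; lra.
  rewrite /chol33 /chol32 e a0 mul0r expr0n/= subr0 sqr_sqrtr; first by split; lra.
  by lra.
have b : chol22 r12 * chol32 r12 r13 r23 = r23 - r12 * r13.
  by rewrite /chol32 mulrCA divff// mulr1.
have c0 : 0 <= 1 - r13 ^+ 2 - chol32 r12 r13 r23 ^+ 2.
  have : 0 < chol22 r12 ^+ 2 by rewrite exprn_even_gt0.
  move=> /pmulr_rge0 <-.
  have -> : chol22 r12 ^+ 2 * (1 - r13 ^+ 2 - chol32 r12 r13 r23 ^+ 2) =
    chol22 r12 ^+ 2 * (1 - r13 ^+ 2) - (chol22 r12 * chol32 r12 r13 r23) ^+ 2.
    by ring.
  rewrite b a2.
  have -> : (1 - r12 ^+ 2) * (1 - r13 ^+ 2) - (r23 - r12 * r13) ^+ 2 =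
    1 + 2 * r12 * r13 * r23 - r12 ^+ 2 - r13 ^+ 2 - r23 ^+ 2 by ring.
  by [].
split; first by rewrite a2; ring.
  by rewrite /chol33 sqr_sqrtr//; ring.
by rewrite b; ring.
Qed.

End normal_distribution_functions.

Section brownian_motion.
Context d (Omega : measurableType d) (R : realType) (P : probability Omega R).

(* Mutual independence; subfamilies are covered by taking A i = setT. *)
Definition mutually_independent n (X : 'I_n -> Omega -> R) : Prop :=
  forall A : 'I_n -> set R, (forall i, measurable (A i)) ->
    P [set w | forall i, A i (X i w)] = (\prod_(i < n) P (X i @^-1` A i))%E.

(* Time is a real number, but only W r with 0 <= r is constrained and used. *)
Definition standard_brownian_motion (W : R -> {RV P >-> R}) : Prop :=
  [/\ {ae P, forall w, W 0 w = 0},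
      (forall w, {within `[0, +oo[, continuous (fun r => W r w)}),
      (forall (n : nat) (r : nat -> R), 0 <= r 0%N ->
         (forall i, r i <= r i.+1) ->
         mutually_independent
           (fun (i : 'I_n) w => W (r i.+1) w - W (r i) w)) &
      (forall r r' : R, 0 <= r -> r < r' -> forall A : set R, measurable A ->
         P [set w | A (W r' w - W r w)] =
           normal_prob 0 (Num.sqrt (r' - r)) A)].

Definition sigma_generated (W : R -> {RV P >-> R}) : set (set Omega) :=
  <<s [set E | exists r (A : set R),
         [/\ 0 <= r, measurable A & E = W r @^-1` A]] >>.

Definition independent_processes (W1 W2 : R -> {RV P >-> R}) : Prop :=
  forall E1 E2, sigma_generated W1 E1 -> sigma_generated W2 E2 ->
    P (E1 `&` E2) = (P E1 * P E2)%E.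

Definition B1 (rho : R) (W1 W2 : R -> {RV P >-> R}) (r : R) (w : Omega) : R :=
  rho * W2 r w + Num.sqrt (1 - rho ^+ 2) * W1 r w.

Definition B2 (mu : R) (W2 : R -> {RV P >-> R}) (r : R) (w : Omega) : R :=
  W2 r w + mu * r.

(* The supremum over [s, t] is a maximum, since paths are continuous. *)
Definition running_max (B : R -> Omega -> R) (s t : R) (w : Omega) : R :=
  sup [set B r w | r in `[s, t]].

End brownian_motion.

(* Main.v *)
Require Import Defs.
From HB Require Import structures.
From mathcomp Require Import all_boot all_order all_algebra.
From mathcomp Require Import all_classical all_reals all_analysis.
From mathcomp Require Import measurable_realfun.
From mathcomp Require Import ring lra.

(* Write X_r = W^2_r - W^2_0 + mu r and B^1_T = rho (X_t - mu t) + G, where the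
   residual G is independent of (X_r)_{r <= t}. On {X_s <= y, max X > y}, X_t is
   reflected at the first point x of a grid of [s, t] where X exceeds y: if Z is
   normal with mean mu tau and variance tau, then E f(Z) = E [f(- Z) e^{-2 mu Z}],
   and the increment Z = X_t - x is independent of the past and of G. As the grid
   is refined, x tends to y by continuity of the paths, and dominated convergence
   yields the reflection principle with drift. Two more tilts, of X_t - X_s and of
   X_s, turn its right-hand side into e^{2 mu y} times the probability of an event
   on (X_s, X_t, G). Both Gaussian probabilities are values of Phi3 once the
   Markov chain X_s, X_t, B^1_T is reversed in time, by two orthogonal reflections
   of the plane.

   The two margins have no atoms: B^1_T is normal, and for the maximum this
   follows from the continuity in y of the joint law. Hence F (F^{-1} v) = v, and
   the law of (F_1 B^1_T, F_2 M^2) is a copula of (B^1_T, M^2). *)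

Set Implicit Arguments.
Unset Strict Implicit.
Unset Printing Implicit Defensive.

Import Order.TTheory GRing.Theory Num.Theory.
Import numFieldNormedType.Exports.
Import HBNNSimple.

Local Open Scope classical_set_scope.
Local Open Scope ring_scope.

(** * Lebesgue and normal integrals *)

(** Reflection is performed at deterministic times only: on the event that the first passage occurs
    at a given grid index, what remains up to [t] is an ordinary Brownian increment, so independence
    of finitely many increments replaces the strong Markov property. The price is an overshoot: the
    level of reflection x lies above y, and the reflected integrand is a discontinuous function of
    x. A discontinuity at x = y is a tie of a Gaussian variable of positive variance, hence null;
    this holds although the residual itself may be degenerate ([rho ^+ 2 = 1] and [t = T]), because
    rho X_t + G has variance T. On the reflected event X_t - x is positive, which bounds the
    exponential weight by an integrable function of X_t alone. The constant e^{2 mu y} is what is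
    left of e^{-2 mu (X_t - y)} once the two final tilts have absorbed e^{-2 mu (X_t - X_s)} and
    e^{-2 mu X_s}. *)

Lemma ge0_integral_density d (T : measurableType d) (R : realType)
    (mu nu : {measure set T -> \bar R}) (p : T -> R) (f : T -> \bar R) :
  measurable_fun setT p -> (forall x, 0 <= p x) ->
  (forall A, measurable A -> nu A = (\int[mu]_(x in A) (p x)%:E)%E) ->
  measurable_fun setT f -> (forall x, 0 <= f x)%E ->
  (\int[nu]_x f x = \int[mu]_x (f x * (p x)%:E))%E.
Proof.
move=> mp p0 nuE mf f0.
pose h := nnsfun_approx measurableT mf.
have hf x : (EFin \o h n) x @[n --> \oo] --> f x.
  exact: (cvg_nnsfun_approx measurableT mf (fun x _ => f0 x)).
have ndh x m n : (m <= n)%N -> h m x <= h n x.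
  by move=> mn; exact/lefP/nd_nnsfun_approx.
have mpE : measurable_fun setT (EFin \o p) by exact/measurable_EFinP.
have mhE n : measurable_fun setT (EFin \o h n) by exact/measurable_EFinP.
(* Both integrals are limits along the same increasing sequence of simple functions. What remains is
   one simple function, where [nuE] applies to each level set. *)
have -> : (\int[nu]_x f x = lim (\int[nu]_x (EFin \o h n) x @[n --> \oo]))%E.
  rewrite -monotone_convergence//.
  - by apply: eq_integral => x _; apply/esym/cvg_lim.
  - by move=> n x _; rewrite lee_fin.
  - by move=> x _ m n mn; rewrite lee_fin ndh.
have -> : (\int[mu]_x (f x * (p x)%:E) =
    lim (\int[mu]_x ((EFin \o h n) x * (p x)%:E) @[n --> \oo]))%E.
  rewrite -monotone_convergence//.
  - apply: eq_integral => x _; apply/esym/cvg_lim => //.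
    by apply: cvgeZr => //; exact: hf.
  - by move=> n; exact: emeasurable_funM.
  - by move=> n x _; rewrite mule_ge0// lee_fin.
  - by move=> x _ m n mn; apply: lee_wpmul2r; rewrite lee_fin// ndh.
congr (limn _); apply/funext => n.
have -> : (\int[nu]_x (EFin \o h n) x =
    \sum_(r \in range (h n)) r%:E * nu (h n @^-1` [set r]))%E.
  by rewrite integralT_nnsfun sintegralE.
under [RHS]eq_integral do rewrite /= fimfunE -fsumEFin//.
have -> : (fun x => ((\sum_(r \in range (h n)) (r * \1_(h n @^-1` [set r]) x)%:E) * (p x)%:E)%E) =
  (fun x => (\sum_(r \in range (h n)) (r%:E * ((p x)%:E * (\1_(h n @^-1` [set r]) x)%:E)))%E).
  apply/funext => x; rewrite ge0_mule_fsuml; last first.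
    by move=> r; exact: nnfun_muleindic_ge0.
  by apply: eq_fsbigr => r _; rewrite EFinM -muleA [X in (_ * X)%E]muleC.
rewrite ge0_integral_fsum//.
- apply: eq_fsbigr => r /[!inE] -[x _ hx].
  rewrite ge0_integralZl//.
  + rewrite nuE// integral_mkcond; congr (_ * _)%E; apply: eq_integral => z _.
    by rewrite epatch_indic.
  + by apply: emeasurable_funM => //; apply/measurable_EFinP/measurable_indic.
  + by move=> z _; rewrite mule_ge0// lee_fin.
  + by rewrite lee_fin -hx.
- move=> r; apply: emeasurable_funM => //; apply: emeasurable_funM => //.
  exact/measurable_EFinP/measurable_indic.
- move=> r x _.
  by rewrite muleCA mule_ge0 ?lee_fin//; have := nnfun_muleindic_ge0 (h n) r x.
Qed.

(** Transparent, so that its values convert to those of [pushforward]. *)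
Definition image_measure d d' (T1 : measurableType d) (T2 : measurableType d')
    (R : realType) (m : {measure set T1 -> \bar R}) (f : T1 -> T2)
    (mf : measurable_fun setT f) : {measure set T2 -> \bar R}.
Proof.
refine (HB.pack_for {measure set T2 -> \bar R} (pushforward m f)
   (Measure.on (pushforward m f))); exact: mf.
Defined.

Section lebesgue_affine.
Context (R : realType).
Notation leb := (@lebesgue_measure R).

Let affine (a b : R) (x : measurableTypeR R) : measurableTypeR R := a * x + b.

Let measurable_affine a b : measurable_fun setT (affine a b).
Proof. by apply: measurable_funD => //; exact: measurable_funM. Qed.

(** Uniqueness of Lebesgue measure: the right-hand side is a measure in [A] that gives []c, d]] its
    length. For [a < 0] the preimage of []c, d]] is closed on the other side, which does not affect
    its length. *)
Let lebesgue_preimage_affine (a b : R) (A : set R) : a != 0 -> measurable A ->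
  (leb A = `|a|%:E * leb (affine a b @^-1` A))%E.
Proof.
move=> a0 mA.
have na : 0 <= `|a| by [].
pose m' : {measure set (measurableTypeR R) -> \bar R} :=
  mscale (NngNum na) (image_measure leb (measurable_affine a b)).
transitivity (m' A); last by [].
apply: lebesgue_measure_unique => // _ [[c d] _ <-].
have -> : m' `]c, d]%classic = (`|a|%:E * leb (affine a b @^-1` `]c, d]))%E by [].
have [agt|alt|/esym ae] := ltgtP 0 a; last by rewrite ae eqxx in a0.
  have -> : affine a b @^-1` `]c, d] = `](c - b) / a, (d - b) / a]%classic.
    apply/seteqP; split => x /=; rewrite !in_itv/= /affine;
      by rewrite ltr_pdivrMr// ler_pdivlMr// ltrBlDr lerBrDr mulrC.
  rewrite !lebesgue_measure_itv/= !lte_fin ltr_pM2r ?invr_gt0// ltrD2r.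
  case: ifPn => _; last by rewrite mule0.
  by rewrite -!EFinD -EFinM gtr0_norm//; congr EFin; field.
have -> : affine a b @^-1` `]c, d] = `[(d - b) / a, (c - b) / a[%classic.
  apply/seteqP; split => x /=; rewrite !in_itv/= /affine;
    by rewrite ltr_ndivlMr// ler_ndivrMr// ltrBlDr lerBrDr mulrC andbC.
rewrite !lebesgue_measure_itv/= !lte_fin ltr_nM2r ?invr_lt0// ltrD2r.
case: ifPn => _; last by rewrite mule0.
by rewrite -!EFinD -EFinM ltr0_norm//; congr EFin; field.
Qed.

Lemma ge0_integral_affine (a b : R) (f : R -> \bar R) :
  a != 0 -> measurable_fun setT f -> (forall x, 0 <= f x)%E ->
  (\int[leb]_x f x = `|a|%:E * \int[leb]_x f (a * x + b)%R)%E.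
Proof.
move=> a0 mf f0.
have na : 0 <= `|a| by [].
rewrite -(@ge0_integral_pushforward _ _ _ _ _ _ (measurable_affine a b) leb setT f)//.
rewrite -(@ge0_integral_mscale _ _ _ (image_measure leb (measurable_affine a b)) _ _ (NngNum na))//.
apply: eq_measure_integral => A mA _.
exact: (lebesgue_preimage_affine b a0 mA).
Qed.

End lebesgue_affine.

Section lebesgue_measureR.
Context (R : realType).

(* Lebesgue measure on [R] with its default measurable structure:
   [lebesgue_measure] lives on the alias [measurableTypeR R], which makes the
   unification of iterated integrals very slow. *)
Definition lebR : set R -> \bar R := @lebesgue_measure R.

Let lebR0 : lebR set0 = 0%E.
Proof. exact: (measure0 (@lebesgue_measure R)). Qed.

Let lebR_ge0 A : (0 <= lebR A)%E.
Proof. exact: (measure_ge0 (@lebesgue_measure R)). Qed.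

Let lebR_sigma_additive : semi_sigma_additive lebR.
Proof. exact: (@measure_semi_sigma_additive _ _ _ (@lebesgue_measure R)). Qed.

HB.instance Definition _ :=
  isMeasure.Build _ R _ lebR lebR0 lebR_ge0 lebR_sigma_additive.

Let lebR_sigma_finite : sigma_finite setT lebR.
Proof. exact: (sigma_finiteT (@lebesgue_measure R)). Qed.

HB.instance Definition _ :=
  Measure_isSigmaFinite.Build _ _ _ lebR lebR_sigma_finite.

Lemma ge0_integral_lebR (f : R -> \bar R) :
  measurable_fun setT f -> (forall x, 0 <= f x)%E ->
  (\int[lebR]_x f x = \int[@lebesgue_measure R]_x f x)%E.
Proof.
move=> mf f0.
have mid : measurable_fun setT (id : measurableTypeR R -> R).
  by move=> _ A mA; rewrite setTI.
exact: (@ge0_integral_pushforward _ _ _ _ _ _ mid (@lebesgue_measure R) setT).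
Qed.

Lemma ge0_integral_affineR (a b : R) (f : R -> \bar R) :
  a != 0 -> measurable_fun setT f -> (forall x, 0 <= f x)%E ->
  (\int[lebR]_x f x = `|a|%:E * \int[lebR]_x f (a * x + b)%R)%E.
Proof.
move=> a0 mf f0; rewrite !ge0_integral_lebR//; first exact: ge0_integral_affine.
by apply: (measurableT_comp mf); apply: measurable_funD => //; exact: measurable_funM.
Qed.

Lemma ge0_integral_normalR (m s : R) (f : R -> \bar R) :
  measurable_fun setT f -> (forall x, 0 <= f x)%E ->
  (\int[normal_prob m s]_x f x = \int[lebR]_x (f x * (normal_pdf m s x)%:E))%E.
Proof.
move=> mf f0; rewrite ge0_integral_lebR.
- apply: ge0_integral_density => //; first exact: measurable_normal_pdf.
  by move=> x; exact: normal_pdf_ge0.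
- apply: emeasurable_funM => //; apply/measurable_EFinP.
  exact: measurable_normal_pdf.
- by move=> x; rewrite mule_ge0// lee_fin normal_pdf_ge0.
Qed.
End lebesgue_measureR.

Section standard_normal.
Context (R : realType).
Notation leb := (@lebR R).

(** The standard normal law on [R] with its default measurable structure, for the same reason as
    [lebR]. *)
Definition gauss : set R -> \bar R := normal_prob (0 : R) 1.

Let gauss0 : gauss set0 = 0%E.
Proof. exact: (measure0 (normal_prob (0 : R) 1)). Qed.

Let gauss_ge0 A : (0 <= gauss A)%E.
Proof. exact: (measure_ge0 (normal_prob (0 : R) 1)). Qed.

Let gauss_sigma_additive : semi_sigma_additive gauss.
Proof. exact: (@measure_semi_sigma_additive _ _ _ (normal_prob (0 : R) 1)). Qed.

HB.instance Definition _ :=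
  isMeasure.Build _ R _ gauss gauss0 gauss_ge0 gauss_sigma_additive.

Let gauss_setT : gauss setT = 1%E.
Proof. exact: (@probability_setT _ _ _ (normal_prob (0 : R) 1)). Qed.

HB.instance Definition _ := Measure_isProbability.Build _ _ R gauss gauss_setT.

Notation N01 := gauss.
Notation phi := (normal_pdf (0 : R) 1).

Lemma normal01_pdfE (x : R) : phi x = normal_peak 1 * expR (- (x ^+ 2 / 2)).
Proof.
by rewrite normal_pdfE ?oner_neq0// /normal_fun subr0 expr1n mulNr.
Qed.

Lemma ge0_integral_gauss (f : R -> \bar R) :
  measurable_fun setT f -> (forall x, 0 <= f x)%E ->
  (\int[N01]_x f x = \int[leb]_x (f x * (phi x)%:E))%E.
Proof.
move=> mf f0; rewrite -ge0_integral_normalR//.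
have mid : measurable_fun setT (id : measurableTypeR R -> R).
  by move=> _ A mA; rewrite setTI.
exact: (@ge0_integral_pushforward _ _ _ _ _ _ mid (normal_prob (0 : R) 1) setT).
Qed.

Lemma ge0_integral_normal_scale (s : R) (f : R -> \bar R) : 0 < s ->
  measurable_fun setT f -> (forall x, 0 <= f x)%E ->
  (\int[normal_prob 0 s]_x f x = \int[N01]_x f (s * x)%R)%E.
Proof.
move=> s0 mf f0.
have mfs : measurable_fun setT (fun x => f (s * x)).
  by apply: (measurableT_comp mf); exact: measurable_funM.
rewrite (ge0_integral_normalR _ _ mf f0) (ge0_integral_gauss mfs (fun _ => f0 _)).
rewrite (@ge0_integral_affineR _ s 0) ?gt_eqF//; last 2 first.
- apply: emeasurable_funM => //; apply/measurable_EFinP.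
  exact: measurable_normal_pdf.
- by move=> x; rewrite mule_ge0// lee_fin normal_pdf_ge0.
rewrite -ge0_integralZl//; last 2 first.
- apply: emeasurable_funM => //.
    by apply: (measurableT_comp mf); apply: measurable_funD => //; exact: measurable_funM.
  apply/measurable_EFinP; apply: (measurableT_comp (measurable_normal_pdf _ _)).
  by apply: measurable_funD => //; exact: measurable_funM.
- by move=> x _; rewrite mule_ge0// lee_fin normal_pdf_ge0.
apply: eq_integral => x _.
rewrite addr0 muleCA -EFinM; congr (_ * _%:E)%E.
rewrite normal01_pdfE normal_pdfE ?gt_eqF// /normal_fun subr0 mulrA.
congr (_ * expR _).
  rewrite /normal_peak gtr0_norm// expr1n mul1r -mulrnAr sqrtrM ?sqr_ge0//.
  by rewrite sqrtr_sqr gtr0_norm// invfM mulrA divff ?gt_eqF// mul1r.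
by rewrite -mulr_natr; field; rewrite gt_eqF.
Qed.

(* Gaussian reflection with drift: if [Z] is normal with mean [mu * s ^+ 2] and
   variance [s ^+ 2], the law of [- Z] has density [exp (- 2 mu z)] with respect
   to that of [Z]. *)
Lemma normal_tilt (mu s : R) (f : R -> \bar R) :
  measurable_fun setT f -> (forall x, 0 <= f x)%E ->
  (\int[N01]_x f (s * x + mu * s ^+ 2)%R =
   \int[N01]_x (f (- (s * x + mu * s ^+ 2))%R *
      (expR (- 2 * mu * (s * x + mu * s ^+ 2)))%:E))%E.
Proof.
move=> mf f0.
have mZ : measurable_fun setT (fun x : R => s * x + mu * s ^+ 2).
  by apply: measurable_funD => //; exact: measurable_funM.
have mg : measurable_fun setT (fun x : R => (f (- (s * x + mu * s ^+ 2))%R *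
      (expR (- 2 * mu * (s * x + mu * s ^+ 2)))%:E)%E).
  apply: emeasurable_funM.
    by apply: (measurableT_comp mf); exact: measurableT_comp.
  apply/measurable_EFinP; apply: measurableT_comp => //.
  exact: measurable_funM.
rewrite !ge0_integral_gauss//; last 2 first.
- by move=> x; rewrite mule_ge0// lee_fin expR_ge0.
- exact: measurableT_comp.
(* The map sending [x] to [- x - 2 * mu * s] changes the sign of [s * x + mu * s ^+ 2], and the
   normal densities at the two points differ exactly by the exponential factor. *)
rewrite [RHS](@ge0_integral_affineR _ (-1) (- 2 * mu * s)) ?oppr_eq0 ?oner_eq0//; last 2 first.
- by apply: emeasurable_funM => //; apply/measurable_EFinP; exact: measurable_normal_pdf.
- by move=> x; rewrite !mule_ge0// lee_fin ?normal_pdf_ge0 ?expR_ge0.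
rewrite normrN1 mul1e; apply: eq_integral => x _.
rewrite -muleA -EFinM; congr (f _ * _%:E)%E; first by ring.
rewrite !normal01_pdfE mulrCA; congr (_ * _).
by rewrite -expRD; congr expR; field.
Qed.

End standard_normal.

Ltac meas_step := match goal with
  | |- forall _, _ => move=> ?
  | |- measurable_fun _ (fun _ => ?c) => exact: measurable_cst
  | |- measurable_fun _ (fun x => x) => exact: measurable_id
  | H : measurable_fun _ ?f |- measurable_fun _ ?f => exact: H
  | |- measurable_fun _ (fun _ => (_, _)) => apply: measurable_fun_pair
  | |- measurable_fun _ (fun _ => _ && _) => apply: measurable_and
  | |- measurable_fun _ (fun _ => (_ <= _)%R) => apply: measurable_fun_ler
  | |- measurable_fun _ (fun _ => (_ < _)%R) => apply: measurable_fun_ltr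
  | |- measurable_fun _ (fun _ => (_ + _)%R) => apply: measurable_funD
  | |- measurable_fun _ (fun _ => (_ * _)%R) => apply: measurable_funM
  | |- measurable_fun _ (fun _ => (- _)%R) => apply: (measurableT_comp (@oppr_measurable _ _))
  | |- measurable_fun _ (fun _ => (_ * _)%E) => apply: emeasurable_funM
  | |- measurable_fun _ (fun _ => (_ + _)%E) => apply: emeasurable_funD
  | |- measurable_fun _ (fun _ => (_)%:E) => apply/measurable_EFinP
  | |- measurable_fun _ (fun _ => expR _) => apply: (measurableT_comp (@measurable_expR _))
  | |- measurable_fun _ (fun x => fst x) => exact: measurable_fst
  | |- measurable_fun _ (fun x => snd x) => exact: measurable_snd
  | |- measurable_fun _ (fun _ => fst _) => apply: (measurableT_comp measurable_fst)
  | |- measurable_fun _ (fun _ => snd _) => apply: (measurableT_comp measurable_snd)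
  | H : measurable_fun _ ?f |- measurable_fun _ (fun x => ?f x) => exact: H
  | H : measurable_fun _ ?f |- measurable_fun _ (fun _ => ?f _) => apply: (measurableT_comp H)
  | H : forall _, measurable_fun _ (?f _) |- measurable_fun _ (fun x => ?f _ x) => exact: H
  | H : forall _, measurable_fun _ (?f _) |- measurable_fun _ (fun _ => ?f _ _) =>
    apply: (measurableT_comp (H _))
  end.
Ltac meas := repeat meas_step.

Section normal_reflection2.
Context (R : realType).
Notation leb := (@lebR R).
Notation N01 := (@gauss R).
Notation phi := (normal_pdf (0 : R) 1).

(** For [c != 0] the reflection is a composition of two affine substitutions in one variable each,
    of slope [- c^-1] in the second coordinate and [c] in the first. Their Jacobians cancel, and
    Tonelli's theorem exchanges the integrals in between. *)
Let lebesgue_reflect2 (c s : R) (K : R * R -> \bar R) :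
  c ^+ 2 + s ^+ 2 = 1 -> c != 0 ->
  measurable_fun setT K -> (forall z, 0 <= K z)%E ->
  (\int[leb]_x \int[leb]_y K (c * x + s * y, s * x - c * y)%R =
   \int[leb]_x \int[leb]_y K (x, y))%E.
Proof.
move=> cs c0 mK K0.
have alg (x y : R) : - c^-1 * y + s / c * (c * x + s * y) = s * x - c * y.
  have -> : s / c * (c * x + s * y) = s * x + s ^+ 2 / c * y by field.
  have -> : s ^+ 2 = 1 - c ^+ 2 by rewrite -cs; ring.
  by field.
have E1 : (\int[leb]_x \int[leb]_y K (x, y) =
    \int[leb]_x \int[leb]_y (`|c^-1|%:E * K (x, - c^-1 * y + s / c * x)%R))%E.
  apply: eq_integral => x _.
  rewrite (@ge0_integral_affineR _ (- c^-1) (s / c * x)) ?oppr_eq0 ?invr_eq0//.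
    by rewrite normrN ge0_integralZl//; meas.
  by meas.
rewrite E1.
pose K1 (z : R * R) := (`|c^-1|%:E * K (z.1, - c^-1 * z.2 + s / c * z.1)%R)%E.
have mK1 : measurable_fun setT K1 by rewrite /K1; meas.
have K10 z : (0 <= K1 z)%E by rewrite /K1 mule_ge0.
rewrite [RHS](@fubini_tonelli _ _ _ _ _ leb leb K1 mK1 K10).
pose K2 (z : R * R) := K (c * z.1 + s * z.2, s * z.1 - c * z.2)%R.
have mK2 : measurable_fun setT K2 by rewrite /K2; meas.
rewrite [LHS](@fubini_tonelli _ _ _ _ _ leb leb K2 mK2 (fun _ => K0 _)).
apply: eq_integral => y _.
rewrite (@ge0_integral_affineR _ c (s * y) (fun x => K1 (x, y)))//; last by rewrite /K1/=; meas.
rewrite /K1/= ge0_integralZl//; last by meas.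
rewrite muleA -EFinM -normrM divff// normr1 mul1e.
apply: eq_integral => x _; congr (K (_, _)); exact/esym/alg.
Qed.

Let normal2_lebesgue (f : R * R -> \bar R) :
  measurable_fun setT f -> (forall z, 0 <= f z)%E ->
  (\int[N01]_x \int[N01]_y f (x, y) =
   \int[leb]_x \int[leb]_y (f (x, y) * (phi x * phi y)%:E))%E.
Proof.
move=> mf f0.
have mphi : measurable_fun setT phi := measurable_normal_pdf 0 1.
rewrite ge0_integral_gauss; last 2 first.
- exact: (@measurable_fun_fubini_tonelli_F _ _ _ _ _ N01 f).
- by move=> x; apply: integral_ge0.
apply: eq_integral => x _.
rewrite ge0_integral_gauss//; last by meas.
rewrite -ge0_integralZr//; last 3 first.
- by meas.
- by move=> y _; rewrite mule_ge0// lee_fin normal_pdf_ge0.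
- by rewrite lee_fin normal_pdf_ge0.
by apply: eq_integral => y _; rewrite -muleA -EFinM [in LHS]mulrC.
Qed.

Lemma normal_reflect1 (f : R -> \bar R) : measurable_fun setT f ->
  (forall x, 0 <= f x)%E -> (\int[N01]_x f (- x)%R = \int[N01]_x f x)%E.
Proof.
move=> mf f0; have := normal_tilt 0 1 mf f0.
under eq_integral do rewrite mul0r addr0 mul1r.
move=> ->; apply: eq_integral => x _.
by rewrite mulr0 mul0r expR0 mule1 mul1r mul0r addr0.
Qed.

(** An orthogonal reflection preserves both Lebesgue measure and [x ^+ 2 + y ^+ 2], hence the
    product density. It is moreover an involution, which makes the later reversals of Gaussian
    chains pure algebra. *)
Lemma normal_reflect2 (c s : R) (f : R * R -> \bar R) :
  c ^+ 2 + s ^+ 2 = 1 ->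
  measurable_fun setT f -> (forall z, 0 <= f z)%E ->
  (\int[N01]_x \int[N01]_y f (c * x + s * y, s * x - c * y)%R =
   \int[N01]_x \int[N01]_y f (x, y))%E.
Proof.
move=> cs mf f0.
have mphi : measurable_fun setT phi := measurable_normal_pdf 0 1.
have [c0|c0] := eqVneq c 0; last first.
  pose K (z : R * R) := (f z * (phi z.1 * phi z.2)%:E)%E.
  have mK : measurable_fun setT K by rewrite /K; meas.
  have K0 z : (0 <= K z)%E by rewrite mule_ge0// lee_fin mulr_ge0 ?normal_pdf_ge0.
  rewrite (@normal2_lebesgue (fun z => f (c * z.1 + s * z.2, s * z.1 - c * z.2)))//;
    last by meas.
  rewrite (normal2_lebesgue mf f0) -(lebesgue_reflect2 cs c0 mK K0).
  apply: eq_integral => x _; apply: eq_integral => y _.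
  rewrite /K/= !normal01_pdfE ; congr (_ * _%:E)%E.
  rewrite mulrACA [RHS]mulrACA -!expRD; congr (_ * expR _).
  have : (c * x + s * y) ^+ 2 + (s * x - c * y) ^+ 2 = x ^+ 2 + y ^+ 2.
    by transitivity ((c ^+ 2 + s ^+ 2) * (x ^+ 2 + y ^+ 2)); [ring|rewrite cs mul1r].
  by move: (_ ^+ 2) (_ ^+ 2) (_ ^+ 2) (_ ^+ 2) => A B C D; lra.
(* For [c = 0] the reflection exchanges the coordinates up to the sign [s], so Tonelli's theorem and
   the symmetry of the normal law suffice. *)
have s1 : `|s| = 1.
  apply/eqP; rewrite -(@eqrXn2 _ 2)// real_normK ?num_real//.
  by move: cs; rewrite c0 expr0n add0r expr1n => ->.
rewrite c0 (@fubini_tonelli _ _ _ _ _ N01 N01 (fun z => f (0 * z.1 + s * z.2, s * z.1 - 0 * z.2)) _ (fun _ => f0 _)); last by meas.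
have sE (g : R -> \bar R) : measurable_fun setT g -> (forall x, 0 <= g x)%E ->
    (\int[N01]_x g (s * x)%R = \int[N01]_x g x)%E.
  move=> mg g0; have [s0|s0] := leP 0 s.
    by move: s1; rewrite ger0_norm// => ->; under eq_integral do rewrite mul1r.
  move: s1; rewrite ltr0_norm// => /eqP; rewrite eqr_oppLR => /eqP ->.
  by under eq_integral do rewrite mulN1r; exact: normal_reflect1.
under eq_integral do under eq_integral do rewrite /= !mul0r subr0 add0r.
have mfy y : measurable_fun setT (fun x => f (s * y, x)) by meas.
transitivity (\int[N01]_y \int[N01]_x f (s * y, x)%R)%E.
  by apply: eq_integral => y _; exact: (sE _ (mfy y) (fun _ => f0 _)).
apply: (sE (fun y => \int[N01]_x f (y, x))%E).
  exact: (@measurable_fun_fubini_tonelli_F _ _ _ _ _ N01 f).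
by move=> x; exact: integral_ge0.
Qed.
End normal_reflection2.

Section product_probability.
Context d1 d2 (T1 : measurableType d1) (T2 : measurableType d2) (R : realType)
  (P : probability T1 R) (Q : probability T2 R).

Let product_setT : (P \x Q)%E setT = 1%E.
Proof.
rewrite -setXTT [LHS]product_measure1E//.
by rewrite [X in (X * _)%E](@probability_setT _ _ _ P)
  [X in (_ * X)%E](@probability_setT _ _ _ Q) mule1.
Qed.

HB.instance Definition _ :=
  Measure_isProbability.Build _ _ R (P \x Q)%E product_setT.

End product_probability.

Lemma integral_probability_cst d (T : measurableType d) (R : realType)
  (P : probability T R) (a : \bar R) : (\int[P]_x a = a)%E.
Proof. by rewrite integral_cst// [X in (_ * X)%E](@probability_setT _ _ _ P) mule1. Qed.

Section normal_linear_images.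
Context (R : realType).
Notation N01 := (@gauss R).

(** With [r] the square root on the right, [(a / r, b / r)] is the first row of a reflection, after
    which the linear form depends on one coordinate only. The case [r = 0] is included because some
    of the variances below may vanish. *)
Lemma normal_sum2 (a b : R) (f : R -> \bar R) :
  measurable_fun setT f -> (forall x, 0 <= f x)%E ->
  (\int[N01]_x \int[N01]_y f (a * x + b * y)%R =
   \int[N01]_x f (Num.sqrt (a ^+ 2 + b ^+ 2) * x)%R)%E.
Proof.
move=> mf f0; set r := Num.sqrt _.
have r2 : r ^+ 2 = a ^+ 2 + b ^+ 2 by rewrite sqr_sqrtr// addr_ge0// sqr_ge0.
have [r0|r0] := eqVneq r 0.
  have : a ^+ 2 + b ^+ 2 == 0 by rewrite -r2 r0 expr0n.
  rewrite paddr_eq0 ?sqr_ge0// !sqrf_eq0 => /andP[/eqP -> /eqP ->].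
  transitivity (f 0).
    rewrite -[RHS](@integral_probability_cst _ _ _ N01); apply: eq_integral => x _.
    rewrite -[RHS](@integral_probability_cst _ _ _ N01); apply: eq_integral => y _.
    by rewrite !mul0r addr0.
  rewrite -[LHS](@integral_probability_cst _ _ _ N01); apply: eq_integral => x _.
  by rewrite r0 mul0r.
have cs : (a / r) ^+ 2 + (b / r) ^+ 2 = 1.
  by rewrite !expr_div_n -mulrDl -r2 divff// sqrf_eq0.
have mF : measurable_fun setT (fun z : R * R => f (r * z.1)) by meas.
transitivity (\int[N01]_x \int[N01]_y f (r * (x, y).1)%R)%E; last first.
  by apply: eq_integral => x _; rewrite /= (@integral_probability_cst _ _ _ N01).
rewrite -(normal_reflect2 cs mF (fun _ => f0 _)).
apply: eq_integral => x _; apply: eq_integral => y _; congr f => /=.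
by field.
Qed.

Lemma measurable_fun_integral_normal d (T : measurableType d) (f : T * R -> \bar R) :
  measurable_fun setT f -> (forall x, 0 <= f x)%E ->
  measurable_fun setT (fun x => \int[N01]_y f (x, y))%E.
Proof. by move=> mf f0; exact: (@measurable_fun_fubini_tonelli_F _ _ _ _ _ N01 f). Qed.

(* Reversal of the Gaussian Markov chain [Z3, Z2, Z1]: on the left it is
   generated starting from [Z3], on the right starting from [Z1]. *)
Lemma normal3_reverse (r12 q r23 s : R) (F : R * R * R -> \bar R) :
  r12 ^+ 2 + q ^+ 2 = 1 -> r23 ^+ 2 + s ^+ 2 = 1 ->
  measurable_fun setT F -> (forall z, 0 <= F z)%E ->
  (\int[N01]_x \int[N01]_y \int[N01]_z
     F (r12 * (r23 * x + s * y) + q * z, r23 * x + s * y, x)%R =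
   \int[N01]_x \int[N01]_y \int[N01]_z
     F (x, r12 * x + q * y, r23 * (r12 * x + q * y) + s * z)%R)%E.
Proof.
move=> e12 e23 mF F0.
pose h (z : R * R) := (\int[N01]_w F (r12 * z.1 + q * w, z.1, r23 * z.1 + s * z.2)%R)%E.
have mh : measurable_fun setT h.
  apply: (measurable_fun_integral_normal
    (f := fun u : (R * R) * R => F (r12 * u.1.1 + q * u.2, u.1.1, r23 * u.1.1 + s * u.1.2))) => //.
  by meas.
have h0 z : (0 <= h z)%E by exact: integral_ge0.
pose k (z : R * R) := (\int[N01]_w F (z.1, r12 * z.1 + q * z.2, r23 * (r12 * z.1 + q * z.2) + s * w)%R)%E.
have mk : measurable_fun setT k.
  apply: (measurable_fun_integral_normal
    (f := fun u : (R * R) * R => F (u.1.1, r12 * u.1.1 + q * u.1.2, r23 * (r12 * u.1.1 + q * u.1.2) + s * u.2))) => //.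
  by meas.
have k0 z : (0 <= k z)%E by exact: integral_ge0.
(* Each reflection moves the starting point of the chain to its middle coordinate [Z2]. Given [Z2]
   the two ends are independent, and the two sides then differ only in the order of integration of
   their noises. *)
transitivity (\int[N01]_x \int[N01]_y k (x, y))%E; last by [].
rewrite -(normal_reflect2 e12 mk k0).
transitivity (\int[N01]_x \int[N01]_y h (x, y))%E.
  rewrite -(normal_reflect2 e23 mh h0).
  apply: eq_integral => x _; apply: eq_integral => y _.
  rewrite /h/=; apply: eq_integral => z _; congr (F (_, _, _)).
  transitivity ((r23 ^+ 2 + s ^+ 2) * x); first by rewrite e23 mul1r.
  by ring.
apply: eq_integral => x _.
rewrite /h/=.
have mG : measurable_fun setT (fun z : R * R => F (r12 * x + q * z.2, x, r23 * x + s * z.1)%R) by meas.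
rewrite (@fubini_tonelli _ _ _ _ _ N01 N01 _ mG (fun _ => F0 _)).
apply: eq_integral => y _; apply: eq_integral => z _ /=.
have -> : r12 * (r12 * x + q * y) + q * (q * x - r12 * y) = x.
  by transitivity ((r12 ^+ 2 + q ^+ 2) * x); [ring|rewrite e12 mul1r].
by [].
Qed.

(** [std_gauss3] is built over the alias [measurableTypeR R], the iterated integral over [R].
    Uniqueness of product measures, applied at both levels of the product, identifies them. *)
Lemma std_gauss3E (A : set (R * R * R)) : measurable A ->
  (std_gauss3 A = \int[N01]_x \int[N01]_y \int[N01]_z (\1_A (x, y, z))%:E)%E.
Proof.
move=> mA.
have mf : measurable_fun setT (fun z => (\1_A z)%:E : \bar R).
  by apply/measurable_EFinP; exact: measurable_indic.
have f0 (z : R * R * R) : (0 <= (\1_A z)%:E :> \bar R)%E by rewrite lee_fin.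
rewrite -(@fubini_tonelli1 _ _ _ _ _ N01 N01 _ (measurable_fun_integral_normal mf f0));
  last by move=> z; exact: integral_ge0.
pose N2 : probability (R * R)%type R := (N01 \x N01)%E.
rewrite -(@fubini_tonelli1 _ _ _ _ _ N2 N01 _ mf f0).
rewrite integral_indic// setIT.
pose N : probability (measurableTypeR R) R :=
  normal_prob (0 : R) 1.
pose NN : probability (measurableTypeR R * measurableTypeR R)%type R :=
  (N \x N)%E.
pose N3 : probability
    (measurableTypeR R * measurableTypeR R * measurableTypeR R)%type R :=
  (NN \x N)%E.
have m2 : measurable_fun setT (id : measurableTypeR R * measurableTypeR R -> R * R).
  by move=> _ B mB; rewrite setTI.
have m3 : measurable_fun setT (id :
    measurableTypeR R * measurableTypeR R * measurableTypeR R -> R * R * R).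
  by move=> _ B mB; rewrite setTI.
apply/esym; apply: (@product_measure_unique _ _ _ _ _ N2 N01 (image_measure N3 m3)) => // B C mB mC.
rewrite [LHS](@product_measure1E _ _ _ _ _ NN N)//; congr (_ * _)%E.
apply/esym; apply: (@product_measure_unique _ _ _ _ _ N01 N01
  (image_measure NN m2)) => // B' C' mB' mC'.
exact: (@product_measure1E _ _ _ _ _ N N).
Qed.

End normal_linear_images.

(** * Independence and Brownian increments *)

Section independence.
Context d (Omega : measurableType d) (R : realType) (P : probability Omega R).

(** The hypothesis on rectangles makes the law of [(Y, V)] the product of the law of [Y] and [Q];
    Tonelli's theorem integrates out [V]. *)
Lemma ge0_integral_independent d1 d2 (T1 : measurableType d1)
    (T2 : measurableType d2) (Q : probability T2 R) (Y : Omega -> T1)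
    (V : Omega -> T2) (F : T1 * T2 -> \bar R) :
  measurable_fun setT Y -> measurable_fun setT V ->
  (forall A B, measurable A -> measurable B ->
     P (Y @^-1` A `&` V @^-1` B) = P (Y @^-1` A) * Q B)%E ->
  measurable_fun setT F -> (forall z, 0 <= F z)%E ->
  (\int[P]_w F (Y w, V w) = \int[P]_w \int[Q]_v F (Y w, v))%E.
Proof.
move=> mY mV ind mF F0.
have mYV : measurable_fun setT (fun w => (Y w, V w)) by exact: measurable_fun_pair.
transitivity (\int[pushforward P (fun w => (Y w, V w))]_z F z)%E.
  by rewrite (ge0_integral_pushforward mYV).
pose PY : probability T1 R := distribution P (mfun_Sub (mem_set mY)).
transitivity (\int[(PY \x Q)%E]_z F z)%E.
  apply: eq_measure_integral => A mA _; apply/esym.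
  apply: (product_measure_unique (m' := image_measure P mYV)) => // B C mB mC; exact: ind.
rewrite fubini_tonelli1//.
rewrite (ge0_integral_pushforward mY)//.
- exact: (@measurable_fun_fubini_tonelli_F _ _ _ _ _ Q F).
- by move=> y _; exact: integral_ge0.
Qed.

(** Dynkin's pi-lambda theorem: the events independent of a fixed [D] form a lambda-system. *)
Lemma setI_closed_independent (G : set (set Omega)) (D : set Omega) :
  setI_closed G -> G `<=` measurable -> measurable D ->
  (forall E, G E -> P (E `&` D) = P E * P D)%E ->
  forall E, <<s G >> E -> (P (E `&` D) = P E * P D)%E.
Proof.
move=> GI Gm mD GD E GE.
have sGm : <<s G >> `<=` measurable.
  by apply: smallest_sub => //; exact: sigma_algebra_measurable.
apply: (@dynkin_induction _ (g_sigma_algebraType G) G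
  (fun E => (P (E `&` D) = P E * P D)%E)) => //.
- by rewrite setTI probability_setT mul1e.
- move=> S mS PS.
  have {}mS : @measurable _ Omega S by exact: sGm.
  have Dfin : P D \is a fin_num by rewrite fin_num_measure.
  have Sfin : P S \is a fin_num by rewrite fin_num_measure.
  rewrite probability_setC// muleBl ?mul1e//.
  rewrite -PS setIC -setDE measureD//; first by rewrite setIC.
  by rewrite -ge0_fin_numE.
- move=> F mF tF PF.
  have {}mF n : @measurable _ Omega (F n) by exact: sGm (mF n).
  rewrite setI_bigcupl measure_bigcup//; last 2 first.
  + by move=> n _; exact: measurableI.
  + by apply: trivIset_setIr.
  rewrite measure_bigcup//.
  have -> : P D = (fine (P D))%:E by rewrite fineK// fin_num_measure.
  rewrite muleC -nneseriesZl//.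
  by apply: eq_eseriesr => n _; rewrite [LHS](PF n) fineK ?fin_num_measure// muleC.
Qed.

End independence.

Section independent_increments.
Context d (Omega : measurableType d) (R : realType) (P : probability Omega R).
Context (W1 W2 : R -> {RV P >-> R}) (hW2 : standard_brownian_motion W2)
  (hW : independent_processes W1 W2).
Context (T : R) (T0 : 0 <= T).
Context (n : nat) (r : nat -> R) (r0 : 0 <= r 0%N)
  (r_nd : forall i, r i <= r i.+1).
Notation N01 := (@gauss R).

Definition increment (i : nat) (w : Omega) : R := W2 (r i.+1) w - W2 (r i) w.

Lemma measurable_increment i : measurable_fun setT (increment i).
Proof. exact: measurable_funB. Qed.

(** A pi-system of events that ignore the [j]-th increment, which is expressed by [A j = setT] so
    that families remain indexed by all of ['I_n]. The sigma-algebra it generates serves below as a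
    second measurable structure on [Omega]: being measurable for it is how independence of the
    [j]-th increment is carried to composite variables. *)
Definition other_events (j : 'I_n) : set (set Omega) :=
  [set E | exists (A : 'I_n -> set R) (B : set R),
    [/\ forall i, measurable (A i), measurable B, A j = setT &
        E = [set w | (forall i : 'I_n, A i (increment i w)) /\ B (W1 T w)]]].

Lemma other_events_setI j : setI_closed (other_events j).
Proof.
move=> _ _ [A [B [mA mB Aj ->]]] [A' [B' [mA' mB' A'j ->]]].
exists (fun i => A i `&` A' i), (B `&` B'); split.
- by move=> i; exact: measurableI.
- exact: measurableI.
- by rewrite Aj A'j setIT.
- apply/seteqP; split => w /=.
    by move=> [[AB ?] [AB' ?]]; split; [move=> i; split|split].
  by move=> [AB [? ?]]; split; split => // i; have [] := AB i.
Qed.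

Lemma other_events_measurable j : other_events j `<=` measurable.
Proof.
move=> _ [A [B [mA mB Aj ->]]].
have -> : [set w | (forall i : 'I_n, A i (increment i w)) /\ B (W1 T w)] =
    (\bigcap_(i in [set: 'I_n]) (increment i @^-1` A i)) `&` (W1 T @^-1` B).
  apply/seteqP; split => w /= [AB ?]; split => //; first by move=> i _; exact: AB.
  by move=> i; exact: AB i I.
apply: measurableI; last by rewrite -[X in measurable X]setTI; exact: measurable_funP.
apply: fin_bigcap_measurable => // i _; rewrite -[X in measurable X]setTI.
exact: measurable_increment.
Qed.

Let increments_sigma_generated (A : 'I_n -> set R) : (forall i, measurable (A i)) ->
  sigma_generated W2 [set w | forall i : 'I_n, A i (increment i w)].
Proof.
move=> mA; rewrite /sigma_generated; set G := (X in <<s X>>).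
have mW u : 0 <= u -> measurable_fun setT (W2 u : g_sigma_algebraType G -> R).
  by move=> u0 _ B mB; rewrite setTI; apply: sub_sigma_algebra; exists u, B.
have r_ge0 i : 0 <= r i by elim: i => // i /le_trans; exact.
have -> : [set w | forall i : 'I_n, A i (increment i w)] =
    \bigcap_(i in [set: 'I_n]) (increment i @^-1` A i).
  by apply/seteqP; split => w /= AB i; [move=> _; exact: AB|exact: AB i I].
apply: (@fin_bigcap_measurable _ (g_sigma_algebraType G)) => // i _.
have : measurable_fun setT (increment i : g_sigma_algebraType G -> R).
  by apply: measurable_funB; exact: mW.
by move=> /(_ measurableT _ (mA i)); rewrite setTI.
Qed.

(** On the generating events, independence of the two processes splits off [W1 T], and mutual
    independence of the increments splits off the [j]-th one. *)
Lemma increment_independent j E C : <<s other_events j >> E -> measurable C ->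
  (P (E `&` increment j @^-1` C) = P E * P (increment j @^-1` C))%E.
Proof.
move=> jE mC.
apply: (setI_closed_independent (@other_events_setI j) (@other_events_measurable j)) => //.
  by rewrite -[X in measurable X]setTI; exact: measurable_increment.
move=> _ [A [B [mA mB Aj ->]]].
have sB : sigma_generated W1 (W1 T @^-1` B).
  by apply: sub_sigma_algebra; exists T, B.
have indep A' : (forall i, measurable (A' i)) ->
    (P ([set w | forall i : 'I_n, A' i (increment i w)] `&` W1 T @^-1` B) =
     (\prod_(i < n) P (increment i @^-1` A' i)) * P (W1 T @^-1` B))%E.
  move=> mA'; rewrite setIC hW//; last exact: increments_sigma_generated.
  rewrite muleC; congr (_ * _)%E.
  by have [_ _ + _] := hW2; apply.
(* The [j]-th slot, free since [A j = setT], receives [C]. *)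
pose A' i := if i == j then C else A i.
have mA' i : measurable (A' i) by rewrite /A'; case: ifP.
have -> : [set w | (forall i : 'I_n, A i (increment i w)) /\ B (W1 T w)] =
    [set w | forall i : 'I_n, A i (increment i w)] `&` W1 T @^-1` B by [].
have -> : [set w | forall i : 'I_n, A i (increment i w)] `&` W1 T @^-1` B
      `&` increment j @^-1` C =
    [set w | forall i : 'I_n, A' i (increment i w)] `&` W1 T @^-1` B.
  apply/seteqP; split => w /=.
    move=> [[AB ?] Cw]; split => // i; rewrite /A'.
    by case: eqP => [->|_] //; exact: AB.
  move=> [AB ?]; have := AB j; rewrite /A' eqxx => Cw; split=> //; split => // i.
  have := AB i; rewrite /A'; case: eqP => // -> _.
  by rewrite Aj.
rewrite !indep// (bigD1 j)//= [in RHS](bigD1 j)//= {1}/A' eqxx Aj preimage_setT.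
rewrite probability_setT mul1e [RHS]muleC muleA; congr (_ * _ * _)%E.
by apply: eq_bigr => i ij; rewrite /A' (negbTE ij).
Qed.

Lemma ge0_integral_increment (j : 'I_n) d' (T' : measurableType d')
    (Y : Omega -> T') (F : T' * R -> \bar R) :
  measurable_fun setT (Y : g_sigma_algebraType (other_events j) -> T') ->
  measurable_fun setT F -> (forall z, 0 <= F z)%E ->
  (\int[P]_w F (Y w, increment j w) =
   \int[P]_w \int[N01]_v F (Y w, Num.sqrt (r j.+1 - r j) * v)%R)%E.
Proof.
move=> mY mF F0.
have sub : <<s other_events j >> `<=` measurable.
  apply: smallest_sub; first exact: sigma_algebra_measurable.
  exact: other_events_measurable.
have mY' : measurable_fun setT Y.
  by move=> mT A mA; rewrite setTI; apply: sub; have := mY measurableT _ mA; rewrite setTI.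
(* The law of an increment is given for distinct times only. For equal times the increment is 0, and
   so is the scaled normal variable. *)
have := r_nd j; rewrite le_eqVlt => /predU1P[rE|rlt].
  apply: eq_integral => w _.
  rewrite /increment -rE subrr subrr sqrtr0.
  by rewrite -[LHS](@integral_probability_cst _ _ _ N01); apply: eq_integral => v _; rewrite mul0r.
set s := Num.sqrt _; have s0 : 0 < s by rewrite sqrtr_gt0 subr_gt0.
have ms : measurable_fun setT (fun x : R => s * x) by meas.
pose Q : probability R R := distribution N01 (mfun_Sub (mem_set ms)).
have QE B : measurable B -> Q B = normal_prob 0 s B.
  move=> mB.
  have mI : measurable_fun setT (fun x => (\1_B x)%:E : \bar R).
    by apply/measurable_EFinP; exact: measurable_indic.
  have I0 x : (0 <= (\1_B x)%:E :> \bar R)%E by rewrite lee_fin.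
  have E := ge0_integral_normal_scale s0 mI I0.
  transitivity (\int[normal_prob 0 s]_x (\1_B x)%:E)%E; last first.
    by rewrite integral_indic// setIT.
  have mB' : measurable ((fun x => s * x) @^-1` B).
    by rewrite -[X in measurable X]setTI; exact: (ms measurableT _ mB).
  transitivity (N01 (((fun x => s * x) @^-1` B) `&` setT)); first by rewrite setIT.
  by rewrite E -integral_indic.
transitivity (\int[P]_w \int[Q]_v F (Y w, v))%E.
  apply: ge0_integral_independent; [exact: mY'|exact: measurable_increment| |exact: mF|exact: F0].
  move=> A B mA mB; rewrite increment_independent; last exact: mB; last first.
    by have := mY measurableT _ mA; rewrite setTI.
  congr (_ * _)%E; have [_ _ _ law] := hW2.
  have r_ge0 : 0 <= r j by elim: (nat_of_ord j) => // i /le_trans; exact.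
  by rewrite QE//; exact: law.
apply: eq_integral => w _.
rewrite (ge0_integral_pushforward ms) => //.
exact: measurable_fun_pair2.
Qed.

Lemma measurable_other_increment (j i : 'I_n) : i != j ->
  measurable_fun setT (increment i : g_sigma_algebraType (other_events j) -> R).
Proof.
move=> ij _ C mC; rewrite setTI; apply: sub_sigma_algebra.
exists (fun l => if l == i then C else setT), setT; split => //.
- by move=> l; case: ifP.
- by rewrite eq_sym (negbTE ij).
- apply/seteqP; split => w /=; last by move=> [/(_ i)]; rewrite eqxx.
  by move=> Cw; split => // l; case: eqP => // ->.
Qed.

Lemma measurable_other_terminal (j : 'I_n) :
  measurable_fun setT (W1 T : g_sigma_algebraType (other_events j) -> R).
Proof.
move=> _ C mC; rewrite setTI; apply: sub_sigma_algebra.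
exists (fun=> setT), C; split => //.
by apply/seteqP; split => w /=; [|move=> []].
Qed.

(** A telescoping sum of increments that all precede the [j]-th. *)
Lemma measurable_other_past (j : 'I_n) i : (i <= j)%N ->
  measurable_fun setT
    ((fun w => W2 (r i) w - W2 (r 0%N) w) : g_sigma_algebraType (other_events j) -> R).
Proof.
elim: i => [|i IH] ij.
  by under eq_fun do rewrite subrr; exact: measurable_cst.
have in_ : (i < n)%N by exact: (leq_trans ij (ltnW (ltn_ord j))).
have ne : Ordinal in_ != j by rewrite -val_eqE/= ltn_eqF.
have := measurable_funD (IH (ltnW ij)) (measurable_other_increment ne).
apply: eq_measurable_fun => w _ /=; rewrite /increment/=.
by rewrite addrC addrA subrK.
Qed.

(** Given the other increments and [W1 T], the drifted increment is normal with mean [mu * tau] and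
    variance [tau], so this is [normal_tilt] at [s = Num.sqrt tau] under the integral over [Y]. *)
Lemma increment_tilt (mu : R) (j : 'I_n) d' (T' : measurableType d')
    (Y : Omega -> T') (F : T' * R -> \bar R) :
  measurable_fun setT (Y : g_sigma_algebraType (other_events j) -> T') ->
  measurable_fun setT F -> (forall z, 0 <= F z)%E ->
  let Z w := increment j w + mu * (r j.+1 - r j) in
  (\int[P]_w F (Y w, Z w) =
   \int[P]_w (F (Y w, - Z w)%R * (expR (- 2 * mu * Z w))%:E))%E.
Proof.
move=> mY mF F0 Z; set tau := r j.+1 - r j.
have tau0 : 0 <= tau by rewrite subr_ge0 r_nd.
pose F1 (z : T' * R) := F (z.1, z.2 + mu * tau).
pose F2 (z : T' * R) := (F (z.1, - (z.2 + mu * tau))%R *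
   (expR (- 2 * mu * (z.2 + mu * tau)))%:E)%E.
have mF1 : measurable_fun setT F1 by rewrite /F1; meas.
have mF2 : measurable_fun setT F2 by rewrite /F2; meas.
have F20 z : (0 <= F2 z)%E by rewrite mule_ge0// lee_fin expR_ge0.
transitivity (\int[P]_w F1 (Y w, increment j w))%E; first by [].
transitivity (\int[P]_w F2 (Y w, increment j w))%E; last by [].
rewrite (ge0_integral_increment mY mF1)//; last by move=> z; exact: F0.
rewrite (ge0_integral_increment mY mF2 F20).
apply: eq_integral => w _.
have mf : measurable_fun setT (fun z => F (Y w, z)) by exact: measurable_fun_pair2.
have := normal_tilt mu (Num.sqrt tau) mf (fun _ => F0 _).
by rewrite sqr_sqrtr.
Qed.

End independent_increments.

Section boolean_events.
Context d (T : measurableType d) (R : realType).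

Lemma measurable_fun_indic_bool (b : T -> bool) : measurable_fun setT b ->
  measurable_fun setT (fun x => ((b x)%:R : R)).
Proof.
move=> mb.
have mB : measurable [set x | b x].
  by have := mb measurableT [set true] I; rewrite setTI.
have : measurable_fun setT (\1_[set x | b x] : T -> R) by exact: measurable_indic.
by apply: eq_measurable_fun => x _; rewrite indicE mem_setE.
Qed.

Lemma probability_bool (P : probability T R) (b : T -> bool) : measurable_fun setT b ->
  (\int[P]_x ((b x)%:R : R)%:E = P [set x | b x])%E.
Proof.
move=> mb.
have mB : measurable [set x | b x].
  by have := mb measurableT [set true] I; rewrite setTI.
rewrite -[X in P X](setIT) -integral_indic//; apply: eq_integral => x _.
by rewrite indicE mem_setE.
Qed.

End boolean_events.

(** * First passage on a grid and the running maximum *)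

Section first_passage.
Context (R : realType).

Definition first_above (x : nat -> R) (y : R) (k : nat) : bool :=
  all (fun i => x i <= y) (iota 0 k) && (y < x k).

Lemma first_above_sum0 (x : nat -> R) (y : R) N (h : nat -> R) :
  (y < x 0%N) || [forall k : 'I_N.+1, x k <= y] ->
  \sum_(k < N) (first_above x y k.+1)%:R * h k.+1 = 0.
Proof.
move=> H; apply: big1 => k _; rewrite /first_above.
case/orP: H => [x0|/forallP xk].
  by rewrite /= leNgt x0 mul0r.
have kN : (k.+1 < N.+1)%N by rewrite ltnS.
by have := xk (Ordinal kN); rewrite /= leNgt => /negbTE ->; rewrite andbF mul0r.
Qed.

(** First passages at different indices exclude each other, so one term survives. That
    [x k <= y < x k.+1] at neighbouring indices is what later controls the overshoot. *)
Lemma first_above_sum (x : nat -> R) (y : R) N (h : nat -> R) :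
  x 0%N <= y -> (exists2 k, (k <= N)%N & y < x k) ->
  exists k, [/\ (k < N)%N, x k <= y, y < x k.+1 &
    \sum_(k < N) (first_above x y k.+1)%:R * h k.+1 = h k.+1].
Proof.
move=> x0 [k0 k0N yk0].
have ex : exists k, y < x k by exists k0.
case: (ex_minnP ex) => -[|k] yk kmin; first by move: yk; rewrite ltNge x0.
have kN : (k < N)%N by exact: leq_trans (kmin _ yk0) k0N.
have le_y i : (i <= k)%N -> x i <= y.
  by move=> ik; rewrite leNgt; apply/negP => /kmin; rewrite ltnNge ik.
exists k; split => //; first exact: le_y.
rewrite (bigD1 (Ordinal kN))//= big1 ?addr0.
  rewrite /first_above yk andbT (_ : all _ _ = true) ?mul1r//.
  by apply/allP => i; rewrite mem_iota/= add0n ltnS; exact: le_y.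
move=> i; rewrite -val_eqE/= /first_above => ik.
have [ki|ki|/eqP] := ltngtP i k; last by rewrite (negbTE ik).
  by rewrite [y < _]ltNge le_y// andbF mul0r.
rewrite (_ : all _ _ = false) ?mul0r//.
by apply/negP => /allP/(_ k.+1); rewrite mem_iota/= add0n ltnS ki leNgt yk => /(_ isT).
Qed.

(** The [N]-th grid has [N.+1] steps, so that the mesh never divides by zero. *)
Definition grid (s t : R) N k : R := s + (t - s) * (k%:R / N.+1%:R).

Lemma grid0 s t N : grid s t N 0 = s.
Proof. by rewrite /grid mul0r mulr0 addr0. Qed.

Lemma gridN s t N : grid s t N N.+1 = t.
Proof. by rewrite /grid divff ?pnatr_eq0// mulr1 addrC subrK. Qed.

Lemma le_grid s t N i j : s <= t -> (i <= j)%N -> grid s t N i <= grid s t N j.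
Proof.
by move=> st ij; rewrite lerD2l ler_wpM2l ?subr_ge0// ler_pM2r ?invr_gt0// ler_nat.
Qed.

Lemma grid_itv s t N k : s <= t -> (k <= N.+1)%N -> grid s t N k \in `[s, t].
Proof.
move=> st kN; rewrite in_itv/=; apply/andP; split.
  by rewrite -[leLHS](grid0 s t N) le_grid.
by rewrite -[leRHS](gridN s t N) le_grid.
Qed.

Lemma grid_step s t N k : grid s t N k.+1 - grid s t N k = (t - s) / N.+1%:R.
Proof.
rewrite /grid -(natr1 k).
have : N.+1%:R != 0 :> R by rewrite pnatr_eq0.
by move: (N.+1%:R : R) => n n0; field.
Qed.

Lemma near_grid s t N r : s < t -> r \in `[s, t] ->
  exists2 k, (k <= N.+1)%N & `|r - grid s t N k| <= (t - s) / N.+1%:R.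
Proof.
move=> st; rewrite in_itv/= => /andP[sr rt].
have N0 : 0 < N.+1%:R :> R by [].
have ts : 0 < t - s by rewrite subr_gt0.
pose a := (r - s) / (t - s) * N.+1%:R.
have a0 : 0 <= a by rewrite !mulr_ge0 ?invr_ge0 ?subr_ge0// ltW.
have /andP[ka ak] := Num.Theory.truncn_itv a0.
have aN : a <= N.+1%:R.
  by rewrite -[leRHS]mul1r ler_wpM2r// ler_pdivrMr// mul1r lerD2r.
exists (Num.truncn a); first by rewrite -(ler_nat R) (le_trans ka).
set k := Num.truncn a in ka ak *.
have -> : r - grid s t N k = (t - s) / N.+1%:R * (a - k%:R).
  move: N0; rewrite /grid /a; move: (N.+1%:R : R) => n n0.
  by field; rewrite !gt_eqF.
rewrite ger0_norm; last by rewrite !mulr_ge0 ?subr_ge0 ?invr_ge0// ltW.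
rewrite ler_piMr//; first by rewrite mulr_ge0 ?invr_ge0// ltW.
by rewrite lerBlDl natr1 ltW.
Qed.

(** Uniform continuity with the mesh of the grids as modulus, from the near-covering form of
    compactness of the segment. *)
Lemma uniform_continuity (x : R -> R) s t e : {within `[s, t], continuous x} ->
  0 < e ->
  \forall N \near \oo, forall a b, a \in `[s, t] -> b \in `[s, t] ->
     `|a - b| <= (t - s) / N.+1%:R -> `|x a - x b| < e.
Proof.
move=> cx e0.
have e20 : 0 < e / 2 by rewrite divr_gt0.
have /compact_near_coveringP cov := @segment_compact R s t.
pose p (N : nat) (a : R) := a \in `[s, t] -> forall b, b \in `[s, t] ->
  `|a - b| <= (t - s) / N.+1%:R -> `|x a - x b| < e.
suff : \forall N \near \oo, `[s, t]%classic `<=` p N.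
  by apply: filterS => N pN a b ast bst; exact: pN.
apply: cov => a ast.
have /cvgrPdist_lt/(_ _ e20) : x @ within `[s, t] (nbhs a) --> x a.
  by move/subspace_continuousP : cx; apply.
rewrite near_withinE => /nbhs_ballP[dl /= dl0 Hdl].
have dl20 : 0 < dl / 2 by rewrite divr_gt0.
have close N a' b : `|a - a'| < dl / 2 -> `|t - s| / N.+1%:R < dl / 2 ->
    a' \in `[s, t] -> b \in `[s, t] -> `|a' - b| <= (t - s) / N.+1%:R ->
    `|x a' - x b| < e.
  move=> aa' Nd a'st bst a'b.
  have h1 : `|x a - x a'| < e / 2.
    by apply: Hdl => //; rewrite /ball/= (lt_trans aa')// ltr_pdivrMr// ltr_pMr// ltr1n.
  have h2 : `|x a - x b| < e / 2.
    apply: Hdl => //; rewrite /ball/= (le_lt_trans (ler_distD a' _ _))//.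
    rewrite [ltRHS]splitr ltrD// (le_lt_trans a'b)// (le_lt_trans _ Nd)//.
    by rewrite ler_wpM2r ?invr_ge0// ler_norm.
  rewrite (le_lt_trans (ler_distD (x a) _ _))// [ltRHS]splitr ltrD//.
  by rewrite distrC.
near=> a' N => /= a'st b bst; apply: close => //.
near: N.
have [->|ts0] := eqVneq `|t - s| 0; first by apply: nearW => N; rewrite mul0r.
have ts1 : 0 < `|t - s| by rewrite lt_def ts0/=.
have q0 : 0 < dl / 2 / `|t - s| by rewrite divr_gt0.
have := near_infty_natSinv_lt (PosNum q0); apply: filterS => N /=.
by rewrite (ltr_pdivlMr _ _ ts1) mulrC.
Unshelve. all: by end_near. Qed.

Lemma exists_above_grid (x : R -> R) s t y : s < t ->
  {within `[s, t], continuous x} -> (exists2 r, r \in `[s, t] & y < x r) ->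
  \forall N \near \oo, exists2 k, (k <= N.+1)%N & y < x (grid s t N k).
Proof.
move=> st cx [r rst yr].
have e0 : 0 < x r - y by rewrite subr_gt0.
have := uniform_continuity cx e0; apply: filterS => N unifN.
have [k kN rk] := near_grid N st rst; exists k => //.
have := unifN _ _ rst (grid_itv (ltW st) kN) rk.
by rewrite ltr_norml => /andP[_]; rewrite ltrD2l ltrN2.
Qed.

(** One grid step before the first passage the path is at most [y], so the overshoot is at most the
    oscillation over one step, which tends to 0 by uniform continuity. *)
Lemma first_passage_cvg (x : R -> R) s t y (h : R -> R) : s < t ->
  {within `[s, t], continuous x} -> x s <= y ->
  (exists2 r, r \in `[s, t] & y < x r) -> {for y, continuous h} ->
  (\sum_(k < N.+1) (first_above (x \o grid s t N) y k.+1)%:R *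
     h (x (grid s t N k.+1))) @[N --> \oo] --> h y.
Proof.
move=> st cx xs ex ch; apply/cvgrPdist_lt => e e0.
have /cvgrPdist_lt/(_ _ e0) /nbhs_ballP[dl /= dl0 Hdl] := ch.
near=> N.
have exN : exists2 k, (k <= N.+1)%N & y < (x \o grid s t N) k.
  by near: N; exact: exists_above_grid.
have x0 : (x \o grid s t N) 0%N <= y by rewrite /= grid0.
have [k [kN xk yk ->]] := first_above_sum (fun i => h ((x \o grid s t N) i)) x0 exN.
apply: Hdl; rewrite /ball/=.
have st' := ltW st.
have dk : `|x (grid s t N k.+1) - x (grid s t N k)| < dl.
  have : forall a b, a \in `[s, t] -> b \in `[s, t] ->
     `|a - b| <= (t - s) / N.+1%:R -> `|x a - x b| < dl.
    by near: N; exact: uniform_continuity.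
  apply; [exact: grid_itv|by apply: grid_itv => //; exact: ltnW|].
  by rewrite grid_step ger0_norm// mulr_ge0 ?subr_ge0 ?invr_ge0.
move: xk yk dk => /= xk yk; rewrite ger0_norm ?subr_ge0 ?(le_trans xk (ltW yk))// => dk.
rewrite distrC ger0_norm ?subr_ge0 ?ltW//.
by rewrite (le_lt_trans _ dk)// lerB.
Unshelve. all: by end_near. Qed.

End first_passage.

Section running_maximum.
Context (R : realType) d (Omega : measurableType d) (B : R -> Omega -> R) (s t : R).
Hypothesis st : s < t.
Hypothesis cB : forall w, {within `[s, t], continuous (B ^~ w)}.

Lemma running_max_gt y w :
  y < running_max B s t w <-> exists2 r, r \in `[s, t] & y < B r w.
Proof.
have st' := ltW st.
have [c cst' Bc] := EVT_max st' (@cB w).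
have ubB : ubound [set B r w | r in `[s, t]] (B c w).
  by move=> _ [r rst <-]; exact: Bc.
split=> [yM|[r rst yr]].
  exists c => //; apply: lt_le_trans yM _; apply: ge_sup => //.
  by exists (B c w), c.
apply: lt_le_trans yr _; apply: ub_le_sup; first by exists (B c w).
by exists r.
Qed.

(** Continuity reduces the supremum to countably many times, whence its measurability. *)
Lemma running_max_gt_grid y w : y < running_max B s t w <->
  exists N, exists2 k, (k <= N.+1)%N & y < B (grid s t N k) w.
Proof.
rewrite running_max_gt; split=> [ex|[N [k kN yk]]]; last first.
  by exists (grid s t N k) => //; apply: grid_itv => //; exact: ltW.
have [N _ /(_ N (leqnn N)) []] := exists_above_grid st (@cB w) ex.
by move=> k kN yk; exists N, k.
Qed.

Lemma measurable_running_max : (forall r, measurable_fun setT (B r)) ->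
  measurable_fun setT (running_max B s t).
Proof.
move=> mB _; apply: (measurability _ (RGenOInfty.measurableE R)) => //.
move=> _ [_ [y ->] <-]; rewrite setTI.
have -> : running_max B s t @^-1` `]y, +oo[ =
    \bigcup_N \bigcup_(k in [set k | (k <= N.+1)%N]) [set w | y < B (grid s t N k) w].
  apply/seteqP; split => w /=; rewrite in_itv/= andbT.
    by move=> /running_max_gt_grid[N [k kN yk]]; exists N => //; exists k.
  by move=> [N _ [k kN yk]]; apply/running_max_gt_grid; exists N, k.
apply: bigcupT_measurable => N; apply: bigcup_measurable => k _.
have mE : measurable_fun setT (fun w => y < B (grid s t N k) w) by exact: measurable_fun_ltr.
by have := mE measurableT [set true] I; rewrite setTI.
Qed.

End running_maximum.

(** * The reflection principle *)

Section reflection.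
Context d (Omega : measurableType d) (R : realType) (P : probability Omega R).
Context (W1 W2 : R -> {RV P >-> R}) (hW2 : standard_brownian_motion W2)
  (hW : independent_processes W1 W2).
Context (mu rho sigma s t T : R) (hs : 0 < s) (hst : s < t) (htT : t <= T).
Notation N01 := (@gauss R).

Let T0 : 0 <= T.
Proof. by rewrite ltW// (lt_le_trans hs)// (le_trans (ltW hst)). Qed.

(** [W2 0] vanishes only almost surely; once it is subtracted, the process is a sum of increments on
    every path. *)
Definition drifted r w := W2 r w - W2 0 w + mu * r.
Notation X := drifted.

(* B^1_T = rho W^2_t + residual, with a residual independent of W^2 on [0, t]. *)
Definition residual w := rho * (W2 T w - W2 t w) + sigma * W1 T w.
Notation G := residual.

(* Subdivision of [0, T] isolating the increment between the [k]-th grid point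
   of [s, t] and [t]. *)
Definition times N k i : R :=
  if i is i'.+1 then
    if (i' <= k)%N then grid s t N i' else if i' == k.+1 then t else T
  else 0.

Lemma times_nd N k i : (k <= N.+1)%N -> times N k i <= times N k i.+1.
Proof.
move=> kN; case: i => [|i] /=; first by rewrite grid0 ltW.
have [ik|ki] := leqP i k.
  have [ik'|ki'] := leqP i.+1 k; first by rewrite le_grid// ltW.
  have -> : i = k by apply/eqP; rewrite eqn_leq ik -ltnS ki'.
  by rewrite eqxx -[leRHS](gridN s t N) le_grid// ltW.
have -> : (i < k)%N = false by apply/negbTE; rewrite -leqNgt ltnW.
by rewrite eqSS (gtn_eqF ki); case: ifP.
Qed.

Lemma measurable_drifted r : measurable_fun setT (X r).
Proof. by apply: measurable_funD => //; exact: measurable_funB. Qed.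

Lemma measurable_residual : measurable_fun setT G.
Proof.
by apply: measurable_funD; apply: measurable_funM => //; exact: measurable_funB.
Qed.

Lemma measurable_first_above d' (U : measurableType d') (x : nat -> U -> R) y k :
  (forall i, (i <= k)%N -> measurable_fun setT (x i)) ->
  measurable_fun setT (fun w => first_above (x ^~ w) y k).
Proof.
move=> mx; rewrite /first_above; apply: measurable_and; last first.
  by apply: measurable_fun_ltr => //; exact: mx.
have : {in iota 0 k, forall i, measurable_fun setT (x i)}.
  by move=> i; rewrite mem_iota/= add0n => ik; exact/mx/ltnW.
elim: (iota 0 k) => [|i l IH] ml /=; first exact: measurable_cst.
apply: measurable_and; last first.
  by apply: IH => j jl; apply: ml; rewrite inE jl orbT.
by apply: measurable_fun_ler => //; apply: ml; rewrite mem_head.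
Qed.

Section step.
Context (N k : nat) (kN : (k <= N.+1)%N).

(** This index is [k.+1], the increment from the [k]-th grid point to [t]. Index 0 is the one from 0
    to [s], and [k.+2] the one from [t] to [T], which enters [G]. *)
Let j : 'I_k.+3 := Ordinal (leqnSn k.+2).
Let U := g_sigma_algebraType (other_events (P := P) W1 W2 T (times N k) j).

Let measurable_grid i : (i <= k)%N ->
  measurable_fun setT (X (grid s t N i) : U -> R).
Proof.
move=> ik.
have : measurable_fun setT ((fun w => W2 (times N k i.+1) w - W2 (times N k 0) w) : U -> R).
  by apply: measurable_other_past; rewrite /= ltnS.
rewrite /= ik => mW.
by apply: measurable_funD => //; exact: mW.
Qed.

Let measurable_residual_other : measurable_fun setT (G : U -> R).
Proof.
apply: measurable_funD; apply: measurable_funM => //; last first.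
  exact: measurable_other_terminal.
have ne : (ord_max : 'I_k.+3) != j by rewrite -val_eqE/= eqSS gtn_eqF.
have := measurable_other_increment (W1 := W1) (W2 := W2) (T := T) (r := times N k) ne.
by rewrite /increment/= ltnn leqNgt ltnW// eqxx eqSS gtn_eqF.
Qed.

(** With [k] fixed, [e], [xk] and [G] are functions of [W1 T] and of increments other than the one
    from the [k]-th grid point to [t]. Tilting that increment replaces [X t] by its mirror image
    [2 * xk - X t] and leaves the rest unchanged. *)
Lemma reflection_step (x0 y : R) :
  let e w := first_above (fun i => X (grid s t N i) w) y k in
  let xk w := X (grid s t N k) w in
  (\int[P]_w ([&& e w, rho * (X t w - mu * t) + G w <= x0 & X t w <= y]%:R : R)%:E =
   \int[P]_w ([&& e w, rho * (2 * xk w - X t w - mu * t) + G w <= x0 &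
                2 * xk w - X t w <= y]%:R * expR (- 2 * mu * (X t w - xk w)) : R)%:E)%E.
Proof.
move=> e xk.
have me : measurable_fun setT (e : U -> bool).
  apply: (measurable_first_above (x := fun i => X (grid s t N i) : U -> R)) => i ik.
  exact: measurable_grid.
have mxk : measurable_fun setT (xk : U -> R) by exact: measurable_grid.
pose F (z : bool * R * R * R) : \bar R :=
  ([&& z.1.1.1, rho * (z.1.1.2 + z.2 - mu * t) + z.1.2 <= x0 & z.1.1.2 + z.2 <= y]%:R)%:E.
have mF : measurable_fun setT F.
  by apply/measurable_EFinP; apply: measurable_fun_indic_bool; meas.
have F0 z : (0 <= F z)%E by rewrite lee_fin.
have mY : measurable_fun setT ((fun w => (e w, xk w, G w)) : U -> bool * R * R).
  by apply: measurable_fun_pair => //; exact: measurable_fun_pair.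
have := increment_tilt hW2 hW T0 (lexx 0) (fun i => times_nd i kN) mu mY mF F0.
rewrite /increment /= ltnn leqnn eqxx => E.
have ZE w : W2 t w - W2 (grid s t N k) w + mu * (t - grid s t N k) = X t w - xk w.
  by rewrite /xk /drifted; ring.
transitivity (\int[P]_w F (e w, xk w, G w, X t w - xk w)%R)%E.
  apply: eq_integral => w _; rewrite /F/=.
  by rewrite [xk w + _]addrC subrK.
under eq_integral do rewrite -ZE.
rewrite E; apply: eq_integral => w _.
rewrite ZE /F/= -EFinM.
have -> : xk w - (X t w - xk w) = 2 * xk w - X t w by ring.
by [].
Qed.

End step.

End reflection.

Lemma independent_processes_sym d (Omega : measurableType d) (R : realType)
    (P : probability Omega R) (W1 W2 : R -> {RV P >-> R}) :
  independent_processes W1 W2 -> independent_processes W2 W1.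
Proof. by move=> ind E1 E2 h1 h2; rewrite setIC ind// muleC. Qed.

(** * Gaussian law of the increments and of the residual *)

Section normal3_swap.
Context (R : realType).
Notation N01 := (@gauss R).

Lemma normal3_swap (f : R * R * R -> \bar R) :
  measurable_fun setT f -> (forall z, 0 <= f z)%E ->
  (\int[N01]_z \int[N01]_y \int[N01]_x f (x, y, z) =
   \int[N01]_x \int[N01]_y \int[N01]_z f (x, y, z))%E.
Proof.
move=> mf f0.
transitivity (\int[N01]_z \int[N01]_x \int[N01]_y f (x, y, z))%E.
  apply: eq_integral => z _.
  have mg : measurable_fun setT (fun u : R * R => f (u.2, u.1, z)) by meas.
  exact: (@fubini_tonelli _ _ _ _ _ N01 N01 _ mg (fun _ => f0 _)).
pose h (u : R * R) := (\int[N01]_y f (u.2, y, u.1))%E.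
have mh : measurable_fun setT h.
  apply: (measurable_fun_integral_normal
    (f := fun v : (R * R) * R => f (v.1.2, v.2, v.1.1))) => //.
  by meas.
have h0 u : (0 <= h u)%E by exact: integral_ge0.
rewrite (@fubini_tonelli _ _ _ _ _ N01 N01 _ mh h0).
apply: eq_integral => x _.
have mg : measurable_fun setT (fun u : R * R => f (x, u.2, u.1)) by meas.
exact: (@fubini_tonelli _ _ _ _ _ N01 N01 _ mg (fun _ => f0 _)).
Qed.

End normal3_swap.

Section gaussian_triple.
Context d (Omega : measurableType d) (R : realType) (P : probability Omega R).
Context (W1 W2 : R -> {RV P >-> R}) (hW1 : standard_brownian_motion W1)
  (hW2 : standard_brownian_motion W2) (hW : independent_processes W1 W2).
Context (rho sigma s t T : R) (hs : 0 < s) (hst : s < t) (htT : t <= T).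
Notation N01 := (@gauss R).
Notation G := (residual W1 W2 rho sigma t T).

Let T0 : 0 <= T.
Proof. by rewrite ltW// (lt_le_trans hs)// (le_trans (ltW hst)). Qed.

Lemma ge0_integral_brownian (f : R -> \bar R) :
  measurable_fun setT f -> (forall x, 0 <= f x)%E ->
  (\int[P]_w f (W1 T w) = \int[N01]_x f (Num.sqrt T * x)%R)%E.
Proof.
move=> mf f0.
(* A subdivision with the single increment from 0 to [T], used with the roles of [W1] and [W2]
   exchanged. *)
pose r i : R := if i is 0%N then 0 else T.
have rnd i : r i <= r i.+1 by case: i => //=.
transitivity (\int[P]_w f (W1 T w - W1 0 w)%R)%E.
  apply: ge0_ae_eq_integral => //.
  - exact: (measurableT_comp mf).
  - by apply: (measurableT_comp mf); exact: measurable_funB.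
  - have [+ _ _ _] := hW1; apply: filterS => w W0 _.
    by rewrite W0 subr0.
have mF : measurable_fun setT (fun z : R * R => f z.2) by meas.
have := ge0_integral_increment hW1 (independent_processes_sym hW) T0 (lexx 0) rnd
   (j := @ord0 0) (measurable_cst (0 : R)) mF (fun _ => f0 _).
rewrite /increment/= => ->; rewrite subr0; exact: integral_probability_cst.
Qed.

(** Standard deviation of the residual; it is 0 when [sigma = 0] and [t = T]. *)
Definition residual_sd :=
  Num.sqrt ((sigma * Num.sqrt T) ^+ 2 + (rho * Num.sqrt (T - t)) ^+ 2).
Notation gamma := residual_sd.

Lemma residual_sd2 : gamma ^+ 2 = sigma ^+ 2 * T + rho ^+ 2 * (T - t).
Proof.
rewrite sqr_sqrtr ?addr_ge0 ?sqr_ge0// !exprMn !sqr_sqrtr//.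
by rewrite subr_ge0.
Qed.

(** The three variables are independent centred normals. The increments over [[0, s]], [[s, t]] and
    [[t, T]] are integrated out in turn, then [W1 T]; [normal_sum2] merges the last two into one
    normal variable of deviation [gamma]. *)
Lemma ge0_integral_triple (F : R * R * R -> \bar R) :
  measurable_fun setT F -> (forall z, 0 <= F z)%E ->
  (\int[P]_w F (W2 s w - W2 0 w, W2 t w - W2 s w, G w)%R =
   \int[N01]_x \int[N01]_y \int[N01]_z
     F (Num.sqrt s * x, Num.sqrt (t - s) * y, gamma * z)%R)%E.
Proof.
move=> mF F0.
pose r := times s t T 0 0.
have rnd i : r i <= r i.+1 by exact: times_nd.
have r1 : r 1%N = s by rewrite /r/= grid0.
have r2 : r 2%N = t by [].
have r3 : r 3%N = T by [].
pose j0 : 'I_3 := @Ordinal 3 0 isT.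
pose j1 : 'I_3 := @Ordinal 3 1 isT.
pose j2 : 'I_3 := @Ordinal 3 2 isT.
have minc (i j : 'I_3) : i != j ->
    measurable_fun setT (increment W2 r i : g_sigma_algebraType (other_events W1 W2 T r j) -> R).
  exact: measurable_other_increment.
have mG (j : 'I_3) : j2 != j ->
    measurable_fun setT (G : g_sigma_algebraType (other_events W1 W2 T r j) -> R).
  move=> ne; apply: measurable_funD; apply: measurable_funM => //; last first.
    exact: measurable_other_terminal.
  by have := minc _ _ ne; rewrite /increment r2 r3.
pose F1 (u : R * R * R) := F (u.2, u.1.1, u.1.2).
have mF1 : measurable_fun setT F1 by rewrite /F1; meas.
transitivity (\int[P]_w F1 (increment W2 r 1 w, G w, increment W2 r 0 w))%E.
  by apply: eq_integral => w _; rewrite /F1 /increment r1 r2.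
rewrite (ge0_integral_increment hW2 hW T0 (lexx 0) rnd (j := j0)
  (Y := fun w => (increment W2 r 1 w, G w)) _ mF1 (fun _ => F0 _)); last first.
  by apply: measurable_fun_pair; [exact: (minc j1 j0)|exact: mG].
rewrite [r j0.+1]r1 subr0.
pose F2 (u : R * R) := (\int[N01]_x F1 (u.2, u.1, Num.sqrt s * x)%R)%E.
have mF2 : measurable_fun setT F2.
  apply: (measurable_fun_integral_normal
    (f := fun v : (R * R) * R => F1 (v.1.2, v.1.1, Num.sqrt s * v.2))) => //.
  + by meas.
  + by move=> z; exact: F0.
have F20 u : (0 <= F2 u)%E by apply: integral_ge0 => x _; exact: F0.
transitivity (\int[P]_w F2 (G w, increment W2 r 1 w))%E; first by [].
rewrite (ge0_integral_increment hW2 hW T0 (lexx 0) rnd (j := j1) (mG j1 isT) mF2 F20).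
rewrite [r j1.+1]r2 [r j1]r1.
pose K (g : R) := (\int[N01]_y F2 (g, Num.sqrt (t - s) * y)%R)%E.
have mK : measurable_fun setT K.
  apply: (measurable_fun_integral_normal
    (f := fun v : R * R => F2 (v.1, Num.sqrt (t - s) * v.2))) => //.
  by meas.
have K0 u : (0 <= K u)%E by exact: integral_ge0.
transitivity (\int[P]_w K (G w))%E; first by [].
pose F3 (u : R * R) := K (rho * u.2 + sigma * u.1).
have mF3 : measurable_fun setT F3 by rewrite /F3; meas.
transitivity (\int[P]_w F3 (W1 T w, increment W2 r 2 w))%E; first by [].
rewrite (ge0_integral_increment hW2 hW T0 (lexx 0) rnd (j := j2)
  (measurable_other_terminal (j := j2)) mF3 (fun _ => K0 _)).
rewrite [r j2.+1]r3 [r j2]r2.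
pose F4 (u : R) := (\int[N01]_v F3 (u, Num.sqrt (T - t) * v)%R)%E.
have mF4 : measurable_fun setT F4.
  apply: (measurable_fun_integral_normal
    (f := fun v : R * R => F3 (v.1, Num.sqrt (T - t) * v.2))).
  + by meas.
  + by move=> z; exact: K0.
have F40 u : (0 <= F4 u)%E by apply: integral_ge0 => x _; exact: K0.
transitivity (\int[P]_w F4 (W1 T w))%E; first by [].
rewrite (ge0_integral_brownian mF4 F40).
transitivity (\int[N01]_u \int[N01]_v K ((sigma * Num.sqrt T) * u + (rho * Num.sqrt (T - t)) * v)%R)%E.
  apply: eq_integral => u _; apply: eq_integral => v _; rewrite /F3/=; congr K.
  by rewrite addrC !mulrA.
rewrite (normal_sum2 _ _ mK K0) -/gamma.
rewrite -(@normal3_swap _ (fun u => F (Num.sqrt s * u.1.1, Num.sqrt (t - s) * u.1.2, gamma * u.2)%R))//.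
by meas.
Qed.

Lemma ge0_integral_linear (a b c : R) (f : R -> \bar R) :
  measurable_fun setT f -> (forall x, 0 <= f x)%E ->
  (\int[P]_w f (a * (W2 s w - W2 0 w) + b * (W2 t w - W2 s w) + c * G w)%R =
   \int[N01]_x f (Num.sqrt (a ^+ 2 * s + b ^+ 2 * (t - s) +
     c ^+ 2 * (sigma ^+ 2 * T + rho ^+ 2 * (T - t))) * x)%R)%E.
Proof.
move=> mf f0.
pose F (z : R * R * R) := f (a * z.1.1 + b * z.1.2 + c * z.2).
have mF : measurable_fun setT F by rewrite /F; meas.
transitivity (\int[P]_w F (W2 s w - W2 0 w, W2 t w - W2 s w, G w)%R)%E; first by [].
rewrite (ge0_integral_triple mF (fun _ => f0 _)).
set q := Num.sqrt ((b * Num.sqrt (t - s)) ^+ 2 + (c * gamma) ^+ 2).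
transitivity (\int[N01]_x \int[N01]_y f ((a * Num.sqrt s) * x + q * y)%R)%E.
  apply: eq_integral => x _.
  have mg : measurable_fun setT (fun y : R => f (a * Num.sqrt s * x + y)).
    by apply: (measurableT_comp mf); apply: measurable_funD.
  rewrite -(normal_sum2 _ _ mg (fun _ => f0 _)).
  apply: eq_integral => y _; apply: eq_integral => z _; rewrite /F/=; congr f.
  by rewrite !mulrA !addrA.
rewrite (normal_sum2 _ _ mf f0).
suff -> : (a * Num.sqrt s) ^+ 2 + q ^+ 2 = a ^+ 2 * s + b ^+ 2 * (t - s) +
    c ^+ 2 * (sigma ^+ 2 * T + rho ^+ 2 * (T - t)) by [].
have st0 : 0 <= t - s by rewrite subr_ge0 ltW.
rewrite /q sqr_sqrtr ?addr_ge0 ?sqr_ge0//.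
by rewrite !exprMn residual_sd2 (sqr_sqrtr (ltW hs)) (sqr_sqrtr st0) addrA.
Qed.

Lemma gauss_set1 (x : R) : N01 [set x] = 0%E.
Proof.
have /null_content_dominatesP := normal_prob_dominates (0 : R) 1.
by apply => //; exact: lebesgue_measure_set1.
Qed.

(** A nondegenerate normal variable has no atom. This discards the paths on which an indicator is
    discontinuous in the limits below. *)
Lemma linear_neq_ae (a b c x : R) :
  0 < a ^+ 2 * s + b ^+ 2 * (t - s) + c ^+ 2 * (sigma ^+ 2 * T + rho ^+ 2 * (T - t)) ->
  {ae P, forall w, a * (W2 s w - W2 0 w) + b * (W2 t w - W2 s w) + c * G w != x}.
Proof.
move=> v0.
pose L w := a * (W2 s w - W2 0 w) + b * (W2 t w - W2 s w) + c * G w.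
have mL : measurable_fun setT L.
  have mG : measurable_fun setT G by exact: measurable_residual.
  apply: measurable_funD; [apply: measurable_funD|]; apply: measurable_funM => //;
    exact: measurable_funB.
have mf : measurable_fun setT (fun y : R => ((y == x)%:R : R)%:E).
  by apply/measurable_EFinP; apply: measurable_fun_indic_bool; exact: measurable_fun_eqr.
have f0 y : (0 <= ((y == x)%:R : R)%:E)%E by rewrite lee_fin.
have := ge0_integral_linear a b c mf f0.
set q := Num.sqrt _; have q0 : 0 < q by rewrite sqrtr_gt0.
rewrite (probability_bool P (b := fun w => L w == x)); last exact: measurable_fun_eqr.
rewrite (probability_bool N01 (b := fun y => q * y == x)); last first.
  by apply: measurable_fun_eqr; meas.
have -> : [set y | q * y == x] = [set x / q].
  apply/seteqP; split => y /=; first by move=> /eqP <-; rewrite mulrAC divff ?mul1r//; exact: lt0r_neq0.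
  move=> ->; apply/eqP; rewrite mulrC divfK//; exact: lt0r_neq0.
rewrite [X in _ = X](gauss_set1 _) => PL0.
exists [set w | L w == x]; split => //.
  have mE : measurable_fun setT (fun w => L w == x) by exact: measurable_fun_eqr.
  by have := mE measurableT [set true] I; rewrite setTI.
by move=> w /= h; apply: contrapT => /negP; exact: h.
Qed.

End gaussian_triple.

(** [normal_tilt] with [f = 1] says that a tilted normal law has mass 1, which is the value of the
    exponential moment; [mu = - c / 2] makes the tilt equal to [c]. *)
Lemma gauss_expR_lty (R : realType) (c : R) :
  (\int[@gauss R]_x (expR (c * x))%:E < +oo)%E.
Proof.
have m1 : measurable_fun setT (fun x : R => 1%:E : \bar R) by exact: measurable_cst.
have := normal_tilt (- c / 2) 1 m1 (fun _ => lee01).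
rewrite integral_probability_cst => E.
have -> : (\int[@gauss R]_x (expR (c * x))%:E =
    (expR (c ^+ 2 / 2))%:E * \int[@gauss R]_x
       (1%:E * (expR (- 2 * (- c / 2) * (1 * x + - c / 2 * 1 ^+ 2)))%:E))%E.
  rewrite -ge0_integralZl//.
  - apply: eq_integral => x _; rewrite mul1e -EFinM -expRD; congr (expR _)%:E.
    by field.
  - by meas.
by rewrite -E mule1 ltry.
Qed.

(** * Passage to the limit along the grids *)

Section reflection_principle.
Context d (Omega : measurableType d) (R : realType) (P : probability Omega R).
Context (W1 W2 : R -> {RV P >-> R}) (hW1 : standard_brownian_motion W1)
  (hW2 : standard_brownian_motion W2) (hW : independent_processes W1 W2).
Context (mu rho sigma s t T : R) (hs : 0 < s) (hst : s < t) (htT : t <= T)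
  (nondegenerate : 0 < rho ^+ 2 + sigma ^+ 2).
Context (x0 y : R).
Notation N01 := (@gauss R).
Notation G := (residual W1 W2 rho sigma t T).
Notation X := (drifted W2 mu).

Lemma drifted_continuous w : {within `[s, t], continuous (X ^~ w)}.
Proof.
have cW : {within `[s, t], continuous (fun r => W2 r w)}.
  have [_ + _ _] := hW2 => /(_ w); apply: continuous_subspaceW => r /=.
  by rewrite !in_itv/= => /andP[sr _]; rewrite andbT (le_trans _ sr)// ltW.
move=> r; apply: cvgD; last first.
  apply: cvgM; first exact: cvg_cst.
  exact: (@continuous_subspaceT _ _ _ id (fun=> cvg_id)).
by apply: cvgB; [exact: cW|exact: cvg_cst].
Qed.

Notation hit w := (y < running_max X s t w).

Let hitE w := running_max_gt_grid hst (@drifted_continuous) y w.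

Let below w : bool := rho * (X t w - mu * t) + G w <= x0.
(** The integrand after reflection at level [a]. It is kept as a function of [a], to be evaluated at
    the grid values of the path and, in the limit, at [y]. *)
Let weight w (a : R) : R :=
  ((rho * (2 * a - X t w - mu * t) + G w <= x0) && (2 * a - X t w <= y))%:R *
  expR (- 2 * mu * (X t w - a)).
Let envelope w : R := expR (2 * `|mu| * (X t w - y)).

(** Integrands before ([sumI]) and after ([sumJ]) reflection on the [N]-th grid. Indices start at 1,
    as a first passage at index 0 means [X s > y]. *)
Let sumI N w : R := \sum_(k < N.+1)
  (first_above (fun i => X (grid s t N i) w) y k.+1)%:R * (below w && (X t w <= y))%:R.
Let sumJ N w : R := \sum_(k < N.+1)
  (first_above (fun i => X (grid s t N i) w) y k.+1)%:R * weight w (X (grid s t N k.+1) w).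

Let mX r : measurable_fun setT (X r). Proof. exact: measurable_drifted. Qed.
Let mG : measurable_fun setT G. Proof. exact: measurable_residual. Qed.
Let mfirst N k :
  measurable_fun setT (fun w => first_above (fun i => X (grid s t N i) w) y k).
Proof.
exact: (measurable_first_above (x := fun i => X (grid s t N i))).
Qed.
Let mbelow : measurable_fun setT below.
Proof. by rewrite /below; meas. Qed.
Let mweight (a : Omega -> R) : measurable_fun setT a ->
  measurable_fun setT (fun w => weight w (a w)).
Proof.
move=> ma; apply: measurable_funM; first by apply: measurable_fun_indic_bool; meas.
by meas.
Qed.
Let msumI N : measurable_fun setT (sumI N).
Proof.
apply: measurable_sum => k; apply: measurable_funM; apply: measurable_fun_indic_bool => //.
by meas.
Qed.
Let msumJ N : measurable_fun setT (sumJ N).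
Proof.
apply: measurable_sum => k; apply: measurable_funM; first exact: measurable_fun_indic_bool.
exact: mweight.
Qed.

Let integral_sums N : (\int[P]_w (sumI N w)%:E = \int[P]_w (sumJ N w)%:E)%E.
Proof.
under eq_integral do rewrite /sumI -sumEFin.
rewrite ge0_integral_sum//; last first.
  move=> k; apply/measurable_EFinP; apply: measurable_funM;
    by apply: measurable_fun_indic_bool => //; meas.
under [RHS]eq_integral do rewrite /sumJ -sumEFin.
rewrite [RHS]ge0_integral_sum//; last 2 first.
- move=> k; apply/measurable_EFinP; apply: measurable_funM.
    exact: measurable_fun_indic_bool.
  exact: mweight.
- by move=> k w _; rewrite lee_fin !mulr_ge0// expR_ge0.
apply: eq_bigr => k _.
have := reflection_step hW2 hW mu rho sigma hs hst htT (ltn_ord k) x0 y.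
move=> /= E; transitivity (\int[P]_w ([&& first_above (fun i => X (grid s t N i) w) y k.+1,
    rho * (X t w - mu * t) + G w <= x0 & X t w <= y]%:R : R)%:E)%E.
  by apply: eq_integral => w _; rewrite -natrM mulnb.
rewrite E; apply: eq_integral => w _.
by rewrite /weight mulrA -natrM mulnb.
Qed.

Let sums_cvg w (h : R -> R) : {for y, continuous h} ->
  (\sum_(k < N.+1) (first_above (fun i => X (grid s t N i) w) y k.+1)%:R *
     h (X (grid s t N k.+1) w)) @[N --> \oo] --> ((X s w <= y) && hit w)%:R * h y.
Proof.
move=> ch; have [/andP[Xs /(running_max_gt hst (@drifted_continuous)) hw]|nh] := boolP ((X s w <= y) && hit w).
  by rewrite mul1r; exact: (first_passage_cvg hst (@drifted_continuous w)).
rewrite mul0r; apply: cvg_near_cst; apply: nearW => N.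
apply: (first_above_sum0 (x := fun i => X (grid s t N i) w)
  (fun i => h (X (grid s t N i) w))).
rewrite grid0; move: nh; rewrite negb_and -ltNge => /orP[->//|nh].
apply/orP; right; apply/forallP => k; rewrite leNgt; apply/negP => yk.
by move/negP: nh; apply; apply/hitE; exists N, k => //; rewrite -ltnS.
Qed.

Let le_const_near (p : R -> R) (c : R) : {for y, continuous p} -> p y != c ->
  \forall a \near y, (p a <= c) = (p y <= c).
Proof.
move=> cp; rewrite neq_lt => /orP[lt|gt].
  near=> a; rewrite [RHS]ltW//; apply/ltW; near: a; exact: (cvgr_lt (p y)).
near=> a; rewrite [RHS]leNgt gt; apply/negbTE; rewrite -ltNge; near: a.
exact: (cvgr_gt (p y)).
Unshelve. all: by end_near. Qed.

(** Off the two ties the indicator is constant for [a] near [y], and only the exponential varies. *)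
Let weight_continuous w : rho * (2 * y - X t w - mu * t) + G w != x0 -> X t w != y ->
  {for y, continuous (weight w)}.
Proof.
move=> tie1 tie2.
have c1 : {for y, continuous (fun a : R => rho * (2 * a - X t w - mu * t) + G w)}.
  apply: cvgD; last exact: cvg_cst.
  apply: cvgM; first exact: cvg_cst.
  apply: cvgB; last exact: cvg_cst.
  apply: cvgB; last exact: cvg_cst.
  by apply: cvgM; [exact: cvg_cst|exact: cvg_id].
have c2 : {for y, continuous (fun a : R => 2 * a - X t w)}.
  apply: cvgB; last exact: cvg_cst.
  by apply: cvgM; [exact: cvg_cst|exact: cvg_id].
have tie2' : 2 * y - X t w != y.
  by apply: contra_neq tie2 => e; lra.
apply: cvgM.
  apply: cvg_near_cst.
  have := le_const_near c1 tie1; apply: filterS2 (le_const_near c2 tie2') => a e2 e1.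
  by rewrite /= e1 e2.
apply: continuous_comp; last exact: continuous_expR.
apply: cvgM; first exact: cvg_cst.
by apply: cvgB; [exact: cvg_cst|exact: cvg_id].
Qed.

(** Where the indicator is 1, [X t - a >= a - y > 0], so the exponent is at most
    [2 * |mu| * (X t - a)], and replacing [a] by the smaller [y] makes the bound uniform in the
    grid. *)
Let weight_le_envelope w a : y < a -> 0 <= weight w a <= envelope w.
Proof.
move=> ya; rewrite /weight /envelope.
have [/andP[_ le]|_] :=
  boolP ((rho * (2 * a - X t w - mu * t) + G w <= x0) && (2 * a - X t w <= y)); last by rewrite mul0r lexx expR_ge0.
rewrite mul1r expR_ge0/= ler_expR.
have mu0 : - mu <= `|mu| by rewrite lerNl lerNnormlW.
have Xa : 0 <= X t w - a by lra.
apply: (@le_trans _ _ (2 * `|mu| * (X t w - a))).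
  by rewrite ler_wpM2r// mulNr -mulrN ler_wpM2l.
by apply: ler_wpM2l; [rewrite mulr_ge0|lra].
Qed.

(** At most one term is nonzero, and it evaluates [h] above [y]. *)
Let sums_bounded w N (h : R -> R) (c : R) : 0 <= c ->
  (forall a, y < a -> 0 <= h a <= c) ->
  0 <= \sum_(k < N.+1) (first_above (fun i => X (grid s t N i) w) y k.+1)%:R *
     h (X (grid s t N k.+1) w) <= c.
Proof.
move=> c0 hc.
pose x i := X (grid s t N i) w.
have [H|H] := boolP ((y < x 0%N) || [forall k : 'I_N.+2, x k <= y]).
  by rewrite (first_above_sum0 (fun i => h (x i)) H) lexx.
move: H; rewrite negb_or -leNgt negb_forall => /andP[x00 /existsP[k]].
rewrite -ltNge => yk.
have ex : exists2 k, (k <= N.+1)%N & y < x k by exists k; rewrite // -ltnS.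
have [l [_ _ yl ->]] := first_above_sum (fun i => h (x i)) x00 ex.
exact: hc.
Qed.

Let envelope_integrable : P.-integrable setT (EFin \o envelope).
Proof.
have menv : measurable_fun setT envelope by rewrite /envelope; meas.
apply/integrableP; split; first exact/measurable_EFinP.
pose f (z : R) := (expR (2 * `|mu| * (z + mu * t - y)))%:E.
have mf : measurable_fun setT f by rewrite /f; meas.
have f0 z : (0 <= f z)%E by rewrite lee_fin expR_ge0.
have -> : (\int[P]_w `|(EFin \o envelope) w| = \int[P]_w
    f (1 * (W2 s w - W2 0 w) + 1 * (W2 t w - W2 s w) + 0 * G w)%R)%E.
  apply: eq_integral => w _ /=; rewrite ger0_norm ?expR_ge0// /f /envelope /drifted.
  by congr (expR _)%:E; ring.
rewrite (ge0_integral_linear hW1 hW2 hW rho sigma hs hst htT 1 1 0 mf f0).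
set q := Num.sqrt _; rewrite /f.
have -> : (\int[N01]_x (expR (2 * `|mu| * (q * x + mu * t - y)))%:E =
    (expR (2 * `|mu| * (mu * t - y)))%:E * \int[N01]_x (expR ((2 * `|mu| * q) * x))%:E)%E.
  rewrite -ge0_integralZl//.
  - apply: eq_integral => x _; rewrite -EFinM -expRD; congr (expR _)%:E.
    by ring.
  - by meas.
have := gauss_expR_lty (2 * `|mu| * q).
by apply: lte_mul_pinfty => //; rewrite lee_fin expR_ge0.
Qed.

(** The variance of the left-hand side is [(rho ^+ 2 + sigma ^+ 2) * T], positive even if that of
    [G] vanishes. *)
Let no_tie_above : {ae P, forall w, rho * (2 * y - X t w - mu * t) + G w != x0}.
Proof.
have v0 : 0 < (- rho) ^+ 2 * s + (- rho) ^+ 2 * (t - s) +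
    1 ^+ 2 * (sigma ^+ 2 * T + rho ^+ 2 * (T - t)).
  have -> : (- rho) ^+ 2 * s + (- rho) ^+ 2 * (t - s) +
    1 ^+ 2 * (sigma ^+ 2 * T + rho ^+ 2 * (T - t)) = (rho ^+ 2 + sigma ^+ 2) * T by ring.
  by rewrite mulr_gt0// (lt_le_trans hs)// (le_trans (ltW hst)).
have := linear_neq_ae hW1 hW2 hW (rho := rho) (sigma := sigma) hs hst htT (x0 - rho * (2 * y - 2 * mu * t)) v0.
apply: filterS => w; apply: contra_neq => <-.
by rewrite /drifted; ring.
Qed.

Let no_tie_end : {ae P, forall w, X t w != y}.
Proof.
have v0 : 0 < 1 ^+ 2 * s + 1 ^+ 2 * (t - s) +
    0 ^+ 2 * (sigma ^+ 2 * T + rho ^+ 2 * (T - t)).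
  by rewrite expr1n !mul1r expr0n mul0r addr0 addrC subrK (lt_trans hs).
have := linear_neq_ae hW1 hW2 hW (rho := rho) (sigma := sigma) hs hst htT (y - mu * t) v0.
apply: filterS => w; apply: contra_neq => <-.
by rewrite /drifted; ring.
Qed.

Lemma reflection_principle :
  (\int[P]_w ([&& X s w <= y, hit w, rho * (X t w - mu * t) + G w <= x0 &
                 X t w <= y]%:R : R)%:E =
   \int[P]_w ([&& X s w <= y, rho * (2 * y - X t w - mu * t) + G w <= x0 &
                 y <= X t w]%:R * expR (- 2 * mu * (X t w - y)) : R)%:E)%E.
Proof.
pose limI w : R := ((X s w <= y) && hit w)%:R * (below w && (X t w <= y))%:R.
pose limJ w : R := ((X s w <= y) && hit w)%:R * weight w y.
have mhit : measurable_fun setT (fun w => hit w).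
  by apply: measurable_fun_ltr => //; exact: measurable_running_max hst (@drifted_continuous) mX.
have mlimI : measurable_fun setT limI.
  by apply: measurable_funM; apply: measurable_fun_indic_bool; meas.
have mlimJ : measurable_fun setT limJ.
  by apply: measurable_funM; [apply: measurable_fun_indic_bool; meas|exact: mweight].
have ci : P.-integrable setT (cst 1%:E : Omega -> \bar R).
  exact: finite_measure_integrable_cst.
have [_ _ cvgI] : [/\ P.-integrable setT (EFin \o limI),
    (\int[P]_w `|(sumI N w)%:E - (limI w)%:E| @[N --> \oo] --> 0)%E &
    (\int[P]_w (sumI N w)%:E @[N --> \oo] --> \int[P]_w (limI w)%:E)%E].
  apply: (@dominated_convergence _ _ _ P setT measurableT (fun N => EFin \o sumI N) (EFin \o limI) (cst 1%:E)) => //.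
  - by move=> N; exact/measurable_EFinP.
  - exact/measurable_EFinP.
  - apply: aeW => w _; apply: cvg_EFin; first exact: nearW.
    by apply: (@sums_cvg w (fun=> (below w && (X t w <= y))%:R)); exact: cvg_cst.
  - apply: aeW => w N _ /=; rewrite lee_fin.
    have b01 (b : bool) : 0 <= (b%:R : R) <= 1 by case: b; rewrite ?lexx ler01.
    have /andP[s0 s1] := @sums_bounded w N (fun=> (below w && (X t w <= y))%:R) 1 ler01
      (fun _ _ => b01 _).
    by rewrite ger0_norm.
have [_ _ cvgJ] : [/\ P.-integrable setT (EFin \o limJ),
    (\int[P]_w `|(sumJ N w)%:E - (limJ w)%:E| @[N --> \oo] --> 0)%E &
    (\int[P]_w (sumJ N w)%:E @[N --> \oo] --> \int[P]_w (limJ w)%:E)%E].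
  apply: (@dominated_convergence _ _ _ P setT measurableT (fun N => EFin \o sumJ N) (EFin \o limJ) (EFin \o envelope)) => //.
  - by move=> N; exact/measurable_EFinP.
  - exact/measurable_EFinP.
  - apply: filterS2 no_tie_above no_tie_end => w tie1 tie2 _.
    apply: cvg_EFin; first exact: nearW.
    by apply: sums_cvg; exact: weight_continuous.
  - apply: aeW => w N _ /=; rewrite lee_fin.
    have /andP[s0 s1] := @sums_bounded w N (weight w) (envelope w) (expR_ge0 _)
      (@weight_le_envelope w).
    by rewrite ger0_norm.
have limE : (\int[P]_w (limI w)%:E = \int[P]_w (limJ w)%:E)%E.
  have cvgI' : (\int[P]_w (sumJ N w)%:E @[N --> \oo] --> \int[P]_w (limI w)%:E)%E.
    apply: cvg_trans cvgI; apply: near_eq_cvg; apply: nearW => N.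
    exact: integral_sums.
  exact: (cvg_unique _ cvgI' cvgJ).
transitivity (\int[P]_w (limI w)%:E)%E.
  by apply: eq_integral => w _; rewrite /limI -natrM mulnb andbA.
rewrite limE; apply: ge0_ae_eq_integral => //.
- exact/measurable_EFinP.
- apply/measurable_EFinP; apply: measurable_funM; last by meas.
  by apply: measurable_fun_indic_bool; meas.
- by move=> w _; rewrite lee_fin !mulr_ge0// expR_ge0.
- apply: filterS no_tie_end => w tie _; congr EFin.
  rewrite /limJ /weight mulrA -natrM mulnb; congr (_ * _); congr (_%:R); congr nat_of_bool.
  have -> : (2 * y - X t w <= y) = (y <= X t w) by apply/idP/idP; lra.
  have [yX|_] := boolP (y <= X t w); last by rewrite !andbF.
  have -> : hit w = true.
    apply/(running_max_gt hst (@drifted_continuous)); exists t; first by rewrite in_itv/= lexx ltW.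
    by rewrite lt_neqAle yX eq_sym tie.
  by rewrite !andbT.
Qed.

End reflection_principle.

Section reflected_law.
Context d (Omega : measurableType d) (R : realType) (P : probability Omega R).
Context (W1 W2 : R -> {RV P >-> R}) (hW1 : standard_brownian_motion W1)
  (hW2 : standard_brownian_motion W2) (hW : independent_processes W1 W2).
Context (mu rho sigma s t T : R) (hs : 0 < s) (hst : s < t) (htT : t <= T).
Context (x0 y : R).
Notation G := (residual W1 W2 rho sigma t T).
Notation X := (drifted W2 mu).

Let T0 : 0 <= T.
Proof. by rewrite ltW// (lt_le_trans hs)// (le_trans (ltW hst)). Qed.

(** With [Z = X t - X s], the weight is [expR (2 * mu * y)] times the tilts of [Z] and of [X s].
    Reading [increment_tilt] from right to left, each tilt is traded for a change of sign, so
    [(X s, X t)] becomes [(- X s, - X t)]. *)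
Lemma reflected_tilt :
  (\int[P]_w ([&& X s w <= y, rho * (2 * y - X t w - mu * t) + G w <= x0 &
                 y <= X t w]%:R * expR (- 2 * mu * (X t w - y)) : R)%:E =
   \int[P]_w ([&& - X s w <= y, rho * (2 * y + X t w - mu * t) + G w <= x0 &
                 y <= - X t w]%:R * expR (2 * mu * y) : R)%:E)%E.
Proof.
pose r := times s t T 0 0.
have rnd i : r i <= r i.+1 by exact: times_nd.
have r1 : r 1%N = s by rewrite /r/= grid0.
have r2 : r 2%N = t by [].
have r3 : r 3%N = T by [].
pose j0 : 'I_3 := @Ordinal 3 0 isT.
pose j1 : 'I_3 := @Ordinal 3 1 isT.
pose j2 : 'I_3 := @Ordinal 3 2 isT.
have minc (i j : 'I_3) : i != j ->
    measurable_fun setT (increment W2 r i : g_sigma_algebraType (other_events W1 W2 T r j) -> R).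
  exact: measurable_other_increment.
have mG (j : 'I_3) : j2 != j ->
    measurable_fun setT (G : g_sigma_algebraType (other_events W1 W2 T r j) -> R).
  move=> ne; apply: measurable_funD; apply: measurable_funM => //; last first.
    exact: measurable_other_terminal.
  by have := minc _ _ ne; rewrite /increment r2 r3.
pose Z w := X t w - X s w.
have XsE w : increment W2 r 0 w + mu * (r 1%N - r 0%N) = X s w.
  by rewrite /increment r1 /= /drifted subr0.
have ZE w : increment W2 r 1 w + mu * (r 2%N - r 1%N) = Z w.
  by rewrite /increment r1 r2 /Z /drifted; ring.
have mXs : measurable_fun setT (X s : g_sigma_algebraType (other_events W1 W2 T r j1) -> R).
  have : measurable_fun setT ((fun w => increment W2 r 0 w + mu * (r 1%N - r 0%N)) :
      g_sigma_algebraType (other_events W1 W2 T r j1) -> R).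
    by apply: measurable_funD => //; exact: (minc j0 j1).
  by apply: eq_measurable_fun => w _; rewrite XsE.
have mZ : measurable_fun setT (Z : g_sigma_algebraType (other_events W1 W2 T r j0) -> R).
  have : measurable_fun setT ((fun w => increment W2 r 1 w + mu * (r 2%N - r 1%N)) :
      g_sigma_algebraType (other_events W1 W2 T r j0) -> R).
    by apply: measurable_funD => //; exact: (minc j1 j0).
  by apply: eq_measurable_fun => w _; rewrite ZE.
(* The last coordinate enters with a minus sign, so that [F1] at [- Z] is the original integrand
   without the tilt of [Z]; [F2] below does the same for [X s]. *)
pose F1 (u : R * R * R) : \bar R :=
  ([&& u.1.1 <= y, rho * (2 * y - (u.1.1 - u.2) - mu * t) + u.1.2 <= x0 &
      y <= u.1.1 - u.2]%:R * expR (- 2 * mu * (u.1.1 - y)))%:E.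
have mF1 : measurable_fun setT F1.
  apply/measurable_EFinP; apply: measurable_funM; last by meas.
  by apply: measurable_fun_indic_bool; meas.
have F10 u : (0 <= F1 u)%E by rewrite lee_fin mulr_ge0// expR_ge0.
have E1 := increment_tilt hW2 hW T0 (lexx 0) rnd mu (j := j1)
  (Y := fun w => (X s w, G w)) (measurable_fun_pair mXs (mG j1 isT)) mF1 F10.
move: E1 => /=; under eq_integral do rewrite ZE.
under [in X in _ = X -> _]eq_integral do rewrite ZE.
move=> E1.
pose F2 (u : R * R * R) : \bar R :=
  ([&& - u.2 <= y, rho * (2 * y - (- u.2 - u.1.1) - mu * t) + u.1.2 <= x0 &
      y <= - u.2 - u.1.1]%:R * expR (2 * mu * y))%:E.
have mF2 : measurable_fun setT F2.
  apply/measurable_EFinP; apply: measurable_funM; last by meas.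
  by apply: measurable_fun_indic_bool; meas.
have F20 u : (0 <= F2 u)%E by rewrite lee_fin mulr_ge0// expR_ge0.
have E2 := increment_tilt hW2 hW T0 (lexx 0) rnd mu (j := j0)
  (Y := fun w => (Z w, G w)) (measurable_fun_pair mZ (mG j0 isT)) mF2 F20.
move: E2 => /=; under eq_integral do rewrite XsE.
under [in X in _ = X -> _]eq_integral do rewrite XsE.
move=> E2.
transitivity (\int[P]_w (F1 (X s w, G w, - Z w)%R * (expR (- 2 * mu * Z w))%:E))%E.
  apply: eq_integral => w _; rewrite /F1 -EFinM; congr EFin.
  rewrite -[RHS]mulrA -expRD /=.
  have -> : X s w - - Z w = X t w by rewrite /Z; ring.
  by congr (_ * expR _); rewrite /Z; ring.
rewrite -E1.
transitivity (\int[P]_w F2 (Z w, G w, X s w))%E.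
  rewrite E2; apply: eq_integral => w _; rewrite /F1 /F2 -EFinM; congr EFin.
  rewrite -[RHS]mulrA -expRD /= opprK.
  by congr (_ * expR _); ring.
apply: eq_integral => w _; rewrite /F2/=.
have -> : - X s w - Z w = - X t w by rewrite /Z; ring.
by rewrite opprK.
Qed.

End reflected_law.

(** * Joint law of the terminal value and the maximum *)

Section Phi3_joint.
Context (R : realType).
Notation N01 := (@gauss R).

(** [r13 = r12 * r23] is the Markov condition for a Gaussian chain. Under it the Cholesky factor
    generates the chain from its first coordinate, while Brownian increments generate it from its
    last. *)
Lemma Phi3_reverse (z1 z2 z3 r12 r23 : R) : r12 ^+ 2 <= 1 -> r23 ^+ 2 <= 1 ->
  ((Phi3 z1 z2 z3 r12 (r12 * r23) r23)%:E = \int[N01]_x \int[N01]_y \int[N01]_z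
     ([&& r12 * (r23 * x + Num.sqrt (1 - r23 ^+ 2) * y) + Num.sqrt (1 - r12 ^+ 2) * z <= z1,
      r23 * x + Num.sqrt (1 - r23 ^+ 2) * y <= z2 & x <= z3]%:R : R)%:E)%E.
Proof.
move=> h12 h23.
pose F (u : R * R * R) : \bar R := ([&& u.1.1 <= z1, u.1.2 <= z2 & u.2 <= z3]%:R)%:E.
have mF : measurable_fun setT F.
  by apply/measurable_EFinP; apply: measurable_fun_indic_bool; meas.
have F0 u : (0 <= F u)%E by rewrite lee_fin.
set q := Num.sqrt (1 - r12 ^+ 2); set s := Num.sqrt (1 - r23 ^+ 2).
have e12 : r12 ^+ 2 + q ^+ 2 = 1 by rewrite sqr_sqrtr ?subr_ge0//; ring.
have e23 : r23 ^+ 2 + s ^+ 2 = 1 by rewrite sqr_sqrtr ?subr_ge0//; ring.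
have c32 : chol32 r12 (r12 * r23) r23 = r23 * q.
  rewrite /chol32 /chol22 -/q.
  have -> : r23 - r12 * (r12 * r23) = r23 * q ^+ 2.
    have -> : q ^+ 2 = 1 - r12 ^+ 2 by rewrite -e12; ring.
    by ring.
  (* In the singular case the inverse of 0 is 0, and the formula for [chol32] still holds. *)
  have [->|q0] := eqVneq q 0; first by rewrite invr0 !mulr0.
  by rewrite expr2 mulrA mulfK.
have c33 : chol33 r12 (r12 * r23) r23 = s.
  rewrite /chol33 c32 /s; congr Num.sqrt.
  by transitivity (1 - r23 ^+ 2 * (r12 ^+ 2 + q ^+ 2)); [ring|rewrite e12 mulr1].
rewrite -/(F _).
transitivity (\int[N01]_x \int[N01]_y \int[N01]_z
  F (r12 * (r23 * x + s * y) + q * z, r23 * x + s * y, x)%R)%E; last by [].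
rewrite (normal3_reverse e12 e23 mF F0).
pose A : set (R * R * R) := [set g | let Z := normal3 r12 (r12 * r23) r23 g in
                            [/\ Z.1.1 <= z1, Z.1.2 <= z2 & Z.2 <= z3]].
pose b (g : R * R * R) := [&& g.1.1 <= z1, r12 * g.1.1 + q * g.1.2 <= z2 &
    r23 * (r12 * g.1.1 + q * g.1.2) + s * g.2 <= z3].
have AE : A = [set g | b g].
  have E g : (normal3 r12 (r12 * r23) r23 g).2 =
      r23 * (r12 * g.1.1 + q * g.1.2) + s * g.2 by rewrite /= c32 c33; ring.
  by apply/seteqP; split => g; rewrite /A /b /= -E => /and3P.
have mA : measurable A.
  have mb : measurable_fun setT b by rewrite /b; meas.
  by have := mb measurableT [set true] I; rewrite setTI AE.
rewrite /Phi3 -/A fineK; last first.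
  pose N2 : probability (measurableTypeR R * measurableTypeR R)%type R :=
    (normal_prob (0 : R) 1 \x normal_prob (0 : R) 1)%E.
  pose N3 : probability (measurableTypeR R * measurableTypeR R * measurableTypeR R)%type R :=
    (N2 \x normal_prob (0 : R) 1)%E.
  exact: (fin_num_measure N3).
rewrite (std_gauss3E mA); apply: eq_integral => x _; apply: eq_integral => y _.
by apply: eq_integral => z _; rewrite AE indicE mem_setE.
Qed.

(** The sign [e] covers both terms of the copula: after reflection the constraint bears on the
    negative of the past increment, which flips its correlations with the other two variables. *)
Lemma Phi3_brownian d (Omega : measurableType d) (P : probability Omega R)
    (W1 W2 : R -> {RV P >-> R}) (hW1 : standard_brownian_motion W1)
    (hW2 : standard_brownian_motion W2) (hW : independent_processes W1 W2)
    (rho s t T e a b c : R) (hs : 0 < s) (hst : s < t) (htT : t <= T) :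
  rho ^+ 2 <= 1 -> e ^+ 2 = 1 ->
  let sigma := Num.sqrt (1 - rho ^+ 2) in
  P [set w | [&& rho * (W2 t w - W2 0 w) + residual W1 W2 rho sigma t T w <= a,
                W2 t w - W2 0 w <= b & e * (W2 s w - W2 0 w) <= c]] =
   (Phi3 (a / Num.sqrt T) (b / Num.sqrt t) (c / Num.sqrt s)
     (rho * Num.sqrt (t / T)) (rho * Num.sqrt (t / T) * (e * Num.sqrt (s / t)))
     (e * Num.sqrt (s / t)))%:E.
Proof.
move=> hrho e2 sigma.
have t0 : 0 < t := lt_trans hs hst.
have T0 : 0 < T := lt_le_trans t0 htT.
have ss : 0 < Num.sqrt s by rewrite sqrtr_gt0.
have st : 0 < Num.sqrt t by rewrite sqrtr_gt0.
have sT : 0 < Num.sqrt T by rewrite sqrtr_gt0.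
have ts : 0 < t - s by rewrite subr_gt0.
have st_neq0 : Num.sqrt t != 0 by exact: lt0r_neq0.
have sT_neq0 : Num.sqrt T != 0 by exact: lt0r_neq0.
have s2 : sigma ^+ 2 = 1 - rho ^+ 2 by rewrite sqr_sqrtr// subr_ge0.
pose gam := residual_sd rho sigma t T.
have gam0 : 0 <= gam by exact: sqrtr_ge0.
have gam2 : gam ^+ 2 = T - rho ^+ 2 * t.
  by rewrite (residual_sd2 _ _ hs hst htT) s2; ring.
set r12 := rho * Num.sqrt (t / T); set r23 := e * Num.sqrt (s / t).
have r12_2 : r12 ^+ 2 = rho ^+ 2 * (t / T).
  by rewrite exprMn sqr_sqrtr// divr_ge0 ?ltW.
have r23_2 : r23 ^+ 2 = s / t.
  by rewrite exprMn e2 mul1r sqr_sqrtr// divr_ge0 ?ltW.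
have h12 : r12 ^+ 2 <= 1.
  have tT1 : t / T <= 1 by rewrite ler_pdivrMr// mul1r.
  have tT0 : 0 <= t / T by apply: divr_ge0; exact: ltW.
  by rewrite r12_2; apply: mulr_ile1 => //; exact: sqr_ge0.
have h23 : r23 ^+ 2 <= 1 by rewrite r23_2 ler_pdivrMr// mul1r ltW.
have q1E : Num.sqrt (1 - r12 ^+ 2) = gam / Num.sqrt T.
  have -> : 1 - r12 ^+ 2 = (gam / Num.sqrt T) ^+ 2.
    rewrite expr_div_n gam2 sqr_sqrtr ?ltW// r12_2; field; exact: lt0r_neq0.
  by rewrite sqrtr_sqr ger0_norm// divr_ge0// ltW.
have q2E : Num.sqrt (1 - r23 ^+ 2) = Num.sqrt (t - s) / Num.sqrt t.
  have -> : 1 - r23 ^+ 2 = (Num.sqrt (t - s) / Num.sqrt t) ^+ 2.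
    rewrite expr_div_n !sqr_sqrtr ?ltW// r23_2; field; exact: lt0r_neq0.
  by rewrite sqrtr_sqr ger0_norm// divr_ge0// ltW.
have r12E : r12 = rho * Num.sqrt t / Num.sqrt T.
  by rewrite /r12 sqrtrM ?ltW// sqrtrV ?ltW// mulrA.
have r23E : r23 = e * Num.sqrt s / Num.sqrt t.
  by rewrite /r23 sqrtrM ?ltW// sqrtrV ?ltW// mulrA.
have ee (x : R) : e * (Num.sqrt s * (e * x)) = x * Num.sqrt s.
  by transitivity (e ^+ 2 * (x * Num.sqrt s)); [ring|rewrite e2 mul1r].
have E2 (x y : R) : Num.sqrt s * (e * x) + Num.sqrt (t - s) * y =
    (r23 * x + Num.sqrt (t - s) / Num.sqrt t * y) * Num.sqrt t.
  rewrite r23E mulrDl; congr (_ + _); last by rewrite mulrAC divfK.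
  by rewrite mulrAC divfK// mulrA [e * _]mulrC.
have E1 (x y : R) : rho * (x * Num.sqrt t) + gam * y =
    (r12 * x + gam / Num.sqrt T * y) * Num.sqrt T.
  rewrite r12E mulrDl; congr (_ + _); last by rewrite mulrAC divfK.
  by rewrite mulrAC divfK// mulrAC mulrA.
rewrite (Phi3_reverse _ _ _ h12 h23) q1E q2E.
pose F (u : R * R * R) : \bar R := ([&& rho * (u.1.1 + u.1.2) + u.2 <= a,
  u.1.1 + u.1.2 <= b & e * u.1.1 <= c]%:R)%:E.
have mF : measurable_fun setT F.
  by apply/measurable_EFinP; apply: measurable_fun_indic_bool; meas.
have F0 u : (0 <= F u)%E by rewrite lee_fin.
have mX : measurable_fun setT (fun w => W2 t w - W2 0 w) by exact: measurable_funB.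
have mXs : measurable_fun setT (fun w => W2 s w - W2 0 w) by exact: measurable_funB.
have mG : measurable_fun setT (residual W1 W2 rho sigma t T) by exact: measurable_residual.
rewrite -probability_bool; last by meas.
transitivity (\int[P]_w F (W2 s w - W2 0 w, W2 t w - W2 s w, residual W1 W2 rho sigma t T w)%R)%E.
  apply: eq_integral => w _; rewrite /F/=.
  by have -> : W2 s w - W2 0 w + (W2 t w - W2 s w) = W2 t w - W2 0 w by ring.
rewrite (ge0_integral_triple hW1 hW2 hW _ _ hs hst htT mF F0) -/gam.
pose H (x : R) : \bar R := (\int[N01]_y \int[N01]_z
     F (Num.sqrt s * x, Num.sqrt (t - s) * y, gam * z)%R)%E.
have mH : measurable_fun setT H.
  apply: (measurable_fun_integral_normal (f := fun u : R * R =>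
    \int[N01]_z F (Num.sqrt s * u.1, Num.sqrt (t - s) * u.2, gam * z)%R)%E).
    apply: (measurable_fun_integral_normal (f := fun u : (R * R) * R =>
      F (Num.sqrt s * u.1.1, Num.sqrt (t - s) * u.1.2, gam * u.2)%R)%E) => //.
    by meas.
  by move=> z; exact: integral_ge0.
have H0 x : (0 <= H x)%E by apply: integral_ge0 => *; exact: integral_ge0.
(* By symmetry of the normal law [x] may be replaced by [e * x]; as [e ^+ 2 = 1], the third
   constraint then bears on [x] itself, as in [Phi3_reverse]. *)
have HE : (\int[N01]_x H x = \int[N01]_x H (e * x)%R)%E.
  move/eqP: e2; rewrite sqrf_eq1 => /orP[/eqP -> | /eqP ->].
    by under [RHS]eq_integral do rewrite mul1r.
  by under [RHS]eq_integral do rewrite mulN1r; exact/esym/normal_reflect1.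
rewrite -[LHS]/(\int[N01]_x H x)%E HE.
apply: eq_integral => x _; apply: eq_integral => y _.
apply: eq_integral => z _; rewrite /F/=.
by rewrite ee E2 E1 !ler_pdivlMr.
Qed.
End Phi3_joint.

Section joint_law.
Context d (Omega : measurableType d) (R : realType) (P : probability Omega R).
Context (W1 W2 : R -> {RV P >-> R}) (hW1 : standard_brownian_motion W1)
  (hW2 : standard_brownian_motion W2) (hW : independent_processes W1 W2).
Context (mu rho s t T : R) (hs : 0 < s) (hst : s < t) (htT : t <= T)
  (hrho : rho ^+ 2 <= 1).
Notation sigma := (Num.sqrt (1 - rho ^+ 2)).
Notation G := (residual W1 W2 rho sigma t T).
Notation X := (drifted W2 mu).
Notation M := (running_max X s t).

Let T0 : 0 < T.
Proof. by rewrite (lt_le_trans hs)// (le_trans (ltW hst)). Qed.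

Let t0 : 0 < t := lt_trans hs hst.

Let r13E : rho * Num.sqrt (t / T) * Num.sqrt (s / t) = rho * Num.sqrt (s / T).
Proof.
rewrite -mulrA; congr (_ * _); rewrite -sqrtrM; last by rewrite divr_ge0 ?ltW.
by congr Num.sqrt; field; rewrite !gt_eqF.
Qed.

(** [M w <= y] forces [X s w <= y] and [X t w <= y]. The event is therefore the Gaussian event [b]
    minus its part where the maximum exceeds [y], which the reflection principle evaluates. *)
Lemma joint_law_events (x0 y : R) :
  P [set w | (rho * (X t w - mu * t) + G w <= x0) && (M w <= y)] =
  (P [set w | [&& rho * (W2 t w - W2 0 w) + G w <= x0, W2 t w - W2 0 w <= y - mu * t &
        1 * (W2 s w - W2 0 w) <= y - mu * s]%R]
   - (expR (2 * mu * y))%:E *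
     P [set w | [&& rho * (W2 t w - W2 0 w) + G w <= x0 - 2 * rho * y,
          W2 t w - W2 0 w <= - y - mu * t &
          -1 * (W2 s w - W2 0 w) <= y + mu * s]%R])%E.
Proof.
have mG : measurable_fun setT G by exact: measurable_residual.
have mX r : measurable_fun setT (X r) by exact: measurable_drifted.
have cX w : {within `[s, t], continuous (X ^~ w)} by exact: drifted_continuous.
have mM : measurable_fun setT M by exact: measurable_running_max hst (@cX) mX.
have nd : 0 < rho ^+ 2 + sigma ^+ 2.
  by rewrite sqr_sqrtr ?subr_ge0// addrC subrK.
have mset (b : Omega -> bool) : measurable_fun setT b -> measurable [set w | b w].
  by move=> mb; have := mb measurableT [set true] I; rewrite setTI.
pose b w := [&& X s w <= y, rho * (X t w - mu * t) + G w <= x0 & X t w <= y].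
have mb : measurable_fun setT b by rewrite /b; meas.
have bE : [set w | [&& rho * (W2 t w - W2 0 w) + G w <= x0,
    W2 t w - W2 0 w <= y - mu * t & 1 * (W2 s w - W2 0 w) <= y - mu * s]%R] = [set w | b w].
  apply/seteqP; split => w;
  rewrite /b /drifted /= addrK !lerBrDr mul1r; by case/and3P => -> -> ->.
have Pbhit : P [set w | b w && (y < M w)] = ((expR (2 * mu * y))%:E *
     P [set w | [&& rho * (W2 t w - W2 0 w) + G w <= x0 - 2 * rho * y,
          W2 t w - W2 0 w <= - y - mu * t &
          -1 * (W2 s w - W2 0 w) <= y + mu * s]%R])%E.
  have := reflection_principle hW1 hW2 hW mu hs hst htT nd x0 y.
  rewrite (reflected_tilt hW2 hW mu rho sigma hs hst htT x0 y).
  have -> : (\int[P]_w ([&& X s w <= y, (y < M w), rho * (X t w - mu * t) + G w <= x0 &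
                 X t w <= y]%:R : R)%:E)%E = P [set w | b w && (y < M w)].
    rewrite -probability_bool; last by meas.
    apply: eq_integral => w _; congr (_%:R%:E); congr nat_of_bool.
    by rewrite /b; case: (_ <= _); case: ((y < M w)); rewrite ?andbT ?andbF.
  move=> ->; rewrite -probability_bool; last first.
    by rewrite /residual; meas.
  rewrite -ge0_integralZl//; last first.
    by apply/measurable_EFinP; apply: measurable_fun_indic_bool; meas.
  apply: eq_integral => w _; rewrite -EFinM mulrC; congr (_ * _%:R)%:E; congr nat_of_bool.
  rewrite /drifted mulN1r andbC -andbA.
  congr [&& _, _ & _]; apply/idP/idP; lra.
have split_b : [set w | b w] = [set w | b w && (y < M w)] `|`
    [set w | (rho * (X t w - mu * t) + G w <= x0) && (M w <= y)].
  apply/seteqP; split => w /=.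
    move=> bw; case: (ltP y (M w)) => h; [by left; rewrite bw|right].
    by rewrite andbT; case/and3P: bw.
  move=> [/andP[]//|/andP[lx My]].
  have le_y r : r \in `[s, t] -> X r w <= y.
    move=> rst; rewrite leNgt; apply/negP => yX.
    by move: My; rewrite leNgt => /negP; apply; apply/(running_max_gt hst (@cX)); exists r.
  apply/and3P; split => //; apply: le_y; rewrite in_itv/= lexx ?ltW//.
have mlast : measurable [set w | (rho * (X t w - mu * t) + G w <= x0) && (M w <= y)].
  by apply: mset; meas.
have mbh : measurable [set w | b w && (y < M w)] by apply: mset; meas.
have dis : [set w | b w && (y < M w)] `&`
    [set w | (rho * (X t w - mu * t) + G w <= x0) && (M w <= y)] = set0.
  by apply/seteqP; split => // w /= [/andP[_ yM] /andP[_]]; rewrite leNgt yM.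
have := measureU P mbh mlast dis.
rewrite -split_b [X in _ = (X + _)%E -> _]Pbhit bE => E.
rewrite [X in (X - _)%E]E [X in (X - _)%E]addeC addeK// fin_numM// fin_num_measure//.
by apply: mset; rewrite /residual; meas.
Qed.

Lemma joint_law (x0 y : R) :
  P [set w | (rho * (X t w - mu * t) + G w <= x0) && (M w <= y)] =
  (Phi3 (x0 / Num.sqrt T) ((y - mu * t) / Num.sqrt t) ((y - mu * s) / Num.sqrt s)
     (rho * Num.sqrt (t / T)) (rho * Num.sqrt (s / T)) (Num.sqrt (s / t))
   - expR (2 * mu * y) *
     Phi3 ((x0 - 2 * rho * y) / Num.sqrt T) ((- y - mu * t) / Num.sqrt t)
       ((y + mu * s) / Num.sqrt s)
       (rho * Num.sqrt (t / T)) (- (rho * Num.sqrt (s / T))) (- Num.sqrt (s / t)))%:E.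
Proof.
rewrite joint_law_events EFinB EFinM.
have := Phi3_brownian hW1 hW2 hW (e := 1) x0 (y - mu * t) (y - mu * s) hs hst htT hrho
  (expr1n _ _).
rewrite !mul1r r13E => ->.
have := Phi3_brownian hW1 hW2 hW (e := -1) (x0 - 2 * rho * y) (- y - mu * t) (y + mu * s)
  hs hst htT hrho (sqrr_sign _ 1).
by rewrite !mulN1r mulrN r13E => ->.
Qed.

End joint_law.

(** * Copulas of atomless random variables *)

Section continuous_distribution.
Context d (Omega : measurableType d) (R : realType) (P : probability Omega R).
Context (X : Omega -> R) (mX : measurable_fun setT X)
  (atomless : forall x, P [set w | X w = x] = 0%E).
Notation F := (distribution_function P X).

Let mle x : measurable [set w | X w <= x].
Proof.
have mb : measurable_fun setT (fun w => X w <= x) by exact: measurable_fun_ler.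
by have := mb measurableT [set true] I; rewrite setTI.
Qed.

Lemma distribution_functionE x : (F x)%:E = P [set w | X w <= x].
Proof. by rewrite fineK// fin_num_measure. Qed.

Lemma distribution_function_nd x y : x <= y -> F x <= F y.
Proof.
move=> xy; rewrite -lee_fin !distribution_functionE le_measure ?inE//.
by move=> w /= /le_trans; exact.
Qed.

Lemma distribution_function_le1 x : F x <= 1.
Proof. by rewrite -lee_fin distribution_functionE probability_le1. Qed.

Lemma distribution_function_ge0 x : 0 <= F x.
Proof. by rewrite -lee_fin distribution_functionE. Qed.

Let Xm : {RV P >-> R} := mfun_Sub (mem_set mX).

Let cdfE x : cdf Xm x = (F x)%:E.
Proof. by rewrite distribution_functionE. Qed.

Let cdf_fun : cdf Xm = fun x => (F x)%:E.
Proof. by apply/funext => x; exact: cdfE. Qed.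

Lemma distribution_function_gt v : v < 1 -> exists x, v < F x.
Proof.
move=> v1; have := cvg_cdfy1 Xm; rewrite cdf_fun => /fine_cvg/= cF.
have /filter_ex[x vx] : \forall x \near +oo, v < F x by exact: (cvgr_gt 1).
by exists x.
Qed.

Lemma distribution_function_lt v : 0 < v -> exists x, F x < v.
Proof.
move=> v0; have := cvg_cdfNy0 Xm; rewrite cdf_fun => /fine_cvg/= cF.
have /filter_ex[x xv] : \forall x \near -oo, F x < v by exact: (cvgr_lt 0).
by exists x.
Qed.

(** [v <= F q] comes from right continuity, and the converse from left continuity, that is, from the
    absence of atoms. *)
Lemma distribution_quantile v : 0 < v < 1 -> F (quantile F v) = v.
Proof.
move=> /andP[v0 v1]; rewrite /quantile; set A := [set x | v <= F x].
have A0 : A !=set0.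
  by have [x vx] := distribution_function_gt v1; exists x; exact: ltW.
have lbA : has_lbound A.
  have [x xv] := distribution_function_lt v0; exists x => z /= vz.
  rewrite leNgt; apply/negP => zx.
  by have := le_lt_trans (distribution_function_nd (ltW zx)) xv; rewrite ltNge vz.
set q := inf A; apply/eqP; rewrite eq_le; apply/andP; split; last first.
  rewrite leNgt; apply/negP => qv.
  have rc : F x @[x --> q^'+] --> F q.
    by have := @cdf_right_continuous _ _ _ P Xm q; rewrite cdf_fun => /fine_cvg.
  have near_q : \forall x \near q^'+, F x < v /\ q < x.
    near=> x; split.
      by near: x; exact: (cvgr_lt (F q)).
    by near: x; exact: nbhs_right_gt.
  have [x [xv qx]] := @filter_ex _ _ (at_right_proper_filter q) _ near_q.
  have : x <= q.
    apply: lb_le_inf => // z /= vz; rewrite leNgt; apply/negP => zx.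
    by have := le_lt_trans (distribution_function_nd (ltW zx)) xv; rewrite ltNge vz.
  by rewrite leNgt qx.
(* These events increase to [X < q], which has the probability of [X <= q]; below the infimum [q]
   the distribution function stays under [v]. *)
pose B n := [set w | X w <= q - n.+1%:R^-1].
have PB : P (\bigcup_n B n) = (F q)%:E.
  have -> : \bigcup_n B n = [set w | X w <= q] `\` [set w | X w = q].
    apply/seteqP; split => w /=.
      move=> [n _ /= Xn].
      have lt : X w < q by rewrite (le_lt_trans Xn)// ltrBlDr ltrDl.
      by split; [exact: ltW|move=> e; rewrite e ltxx in lt].
    move=> [Xq /eqP Xne]; have Xlt : 0 < q - X w by rewrite subr_gt0 lt_neqAle Xne.
    have [n _ /(_ n (leqnn n)) Hn] := near_infty_natSinv_lt (PosNum Xlt).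
    by exists n => //; rewrite /B /= lerBrDr -lerBrDl ltW.
  have mq : measurable [set w | X w = q].
    by have := mX measurableT (measurable_set1 q); rewrite setTI.
  rewrite distribution_functionE measureD//; last by rewrite ltey_eq fin_num_measure.
  have -> : [set w | X w <= q] `&` [set w | X w = q] = [set w | X w = q].
    by apply/seteqP; split => w /=; [move=> []|move=> ->].
  by rewrite [X in (_ - X)%E]atomless sube0.
have cB : P (B n) @[n --> \oo] --> (F q)%:E.
  have mB n : measurable (B n) by exact: mle.
  rewrite -PB; apply: nondecreasing_cvg_mu; first exact: mB.
  - exact: bigcupT_measurable.
  - move=> n m nm; apply/subsetPset => w /= /le_trans; apply.
    by rewrite lerB// lef_pV2 ?posrE// ler_nat.
rewrite -lee_fin; apply: (cvge_le _ cB).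
apply: nearW => n; rewrite -distribution_functionE lee_fin leNgt; apply/negP => vn.
have := @ge_inf _ A lbA (q - n.+1%:R^-1) (ltW vn).
by rewrite -/q lerBrDr gerDl leNgt invr_gt0 ltr0n.
Unshelve. all: by end_near. Qed.

(** [F] may be flat, so [F (X w) <= v] does not imply [X w <= quantile F v]. It does imply
    [X w <= quantile F u] for every [u > v], which gives the upper bound in the limit. *)
Lemma probability_integral_transform v : 0 <= v <= 1 ->
  P [set w | F (X w) <= v] = v%:E.
Proof.
have mF : measurable_fun setT F.
  by apply: nondecreasing_measurable => // x y *; exact: distribution_function_nd.
have mA u : measurable [set w | F (X w) <= u].
  have mb : measurable_fun setT (fun w => F (X w) <= u).
    by apply: measurable_fun_ler => //; exact: measurableT_comp.
  by have := mb measurableT [set true] I; rewrite setTI.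
move=> /andP[v0]; rewrite le_eqVlt => /predU1P[->|v1].
  rewrite (_ : [set w | _] = setT) ?probability_setT//.
  by apply/seteqP; split => w //= _; exact: distribution_function_le1.
have upper u : v < u < 1 -> (P [set w | (F (X w) <= v)%R] <= u%:E)%E.
  move=> /andP[vu u1]; have u0 : 0 < u by exact: le_lt_trans vu.
  have Fq : F (quantile F u) = u by apply: distribution_quantile; rewrite u0.
  rewrite -[in leRHS]Fq distribution_functionE le_measure ?inE// => w /= Fv.
  rewrite leNgt; apply/negP => qX.
  have := distribution_function_nd (ltW qX); rewrite Fq => uF.
  by have := lt_le_trans vu (le_trans uF Fv); rewrite ltxx.
have fp : P [set w | F (X w) <= v] \is a fin_num by rewrite fin_num_measure.
set p := fine (P [set w | F (X w) <= v]).
have pE : P [set w | F (X w) <= v] = p%:E by rewrite fineK.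
have p1 : p <= 1 by rewrite -lee_fin -pE probability_le1.
rewrite pE; congr EFin; apply/eqP; rewrite eq_le; apply/andP; split.
  rewrite leNgt; apply/negP => vp.
  have := upper ((v + p) / 2); rewrite pE lee_fin.
  have -> : v < (v + p) / 2 < 1 by apply/andP; split; lra.
  by move=> /(_ isT); lra.
have /predU1P[<-|v_gt0] : (0 == v) || (0 < v) by rewrite -le_eqVlt.
  by rewrite -lee_fin -pE.
rewrite -lee_fin -pE -{1}(@distribution_quantile v); last by rewrite v_gt0.
rewrite distribution_functionE le_measure ?inE// => w /= Xq.
by rewrite -[leRHS](@distribution_quantile v) ?v_gt0//; exact: distribution_function_nd.
Qed.

End continuous_distribution.

Section uniform_law.
Context (R : realType).

Lemma uniform_prob_ray (v : R) : 0 <= v <= 1 ->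
  uniform_prob (@ltr01 R) `]-oo, v] = v%:E.
Proof.
move=> /andP[v0 v1]; rewrite /uniform_prob integral_uniform_pdf.
have -> : `]-oo, v] `&` `[0, 1] = `[0, v]%classic :> set R.
  apply/seteqP; split => x /=; rewrite !in_itv/=.
    by move=> [xv /andP[-> _]].
  by move=> /andP[-> xv]; rewrite xv (le_trans xv v1).
rewrite (eq_integral (cst 1%:E)); last first.
  move=> x; rewrite inE/= in_itv/= => /andP[x0 xv].
  by rewrite /uniform_pdf x0 (le_trans xv v1) subr0 invr1.
rewrite integral_cst//= lebesgue_measure_itv/= mul1e lte_fin.
case: ltP => [_|v0']; first by rewrite oppr0 adde0.
by congr EFin; apply/eqP; rewrite eq_le v0.
Qed.

(* Only the values of the distribution function on [0, 1] are given; outside,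
   they are forced since the mass of `]-oo, 1] is 1 and that of `]-oo, 0] is 0. *)
Lemma uniform_law_unique (Q : probability R R) :
  (forall v : R, 0 <= v <= 1 -> Q `]-oo, v]%classic = v%:E) ->
  forall A, measurable A -> Q A = uniform_prob (@ltr01 R) A.
Proof.
move=> HQ.
pose U : probability (measurableTypeR R) R := uniform_prob (@ltr01 R).
pose clip (v : R) : R := if v < 0 then 0 else if v <= 1 then v else 1.
have ray (S : {measure set R -> \bar R}) : S setT = 1%E ->
    (forall v : R, 0 <= v <= 1 -> S `]-oo, v]%classic = v%:E) ->
    forall v, S `]-oo, v]%classic = (clip v)%:E.
  move=> S1 HS v; rewrite /clip; case: ltP => [vlt|v0].
    apply/eqP; rewrite eq_le measure_ge0 andbT -[leRHS](HS 0) ?lexx ?ler01//.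
    rewrite le_measure ?inE//; apply: subitvPr; rewrite bnd_simp; exact: ltW.
  case: leP => v1; first by apply: HS; rewrite v0.
  apply/eqP; rewrite eq_le -{1}S1 le_measure ?inE//= -[leLHS](HS 1) ?lexx ?ler01//.
  by rewrite le_measure ?inE//; apply: subitvPr; rewrite bnd_simp; exact: ltW.
have mid : @measurable_fun _ _ (measurableTypeR R) R setT id.
  by move=> _ A mA; rewrite setTI.
pose U' : {measure set R -> \bar R} := image_measure U mid.
have QU x : Q `]-oo, x]%classic = U' `]-oo, x]%classic.
  have U1 : U' setT = 1%E by exact: (@probability_setT _ _ _ U).
  rewrite (ray Q (@probability_setT _ _ _ Q) HQ).
  by rewrite (ray U' U1 uniform_prob_ray).
have U'fin b : (U' `]-oo, b]%classic < +oo)%E by rewrite -QU ltey_eq fin_num_measure.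
move=> A mA; change (Q A = U' A).
apply: (measure_unique (@ocitv R) (fun n => `](- n%:R), n%:R]%classic)) => //.
- exact: ocitvI.
- by move=> n; exact: is_ocitv.
- rewrite -subTset => x _; exists (Num.truncn `|x|).+1 => //=.
  have := truncnS_gt `|x|; rewrite in_itv/= ltr_norml => /andP[-> xn].
  exact: ltW.
- move=> _ [[a b] _ <-] /=.
  have [ab|ba] := leP a b; last by rewrite set_itv_ge ?measure0// bnd_simp -leNgt ltW.
  have -> : `]a, b]%classic = `]-oo, b] `\` `]-oo, a] :> set R.
    by rewrite -[RHS]setCK setCD setCitvl setUC -[LHS]setCK setCitv.
  rewrite !measureD ?setIidr//; try exact: subset_itvl.
  + by rewrite [X in (X - _)%E]QU [X in (_ - X)%E]QU.
  + exact: U'fin.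
  + by rewrite ltey_eq fin_num_measure.
- by move=> k; rewrite ltey_eq fin_num_measure.
Qed.

End uniform_law.

(** [X w <= x] implies [F (X w) <= F x], not conversely. Both events have probability [F x] by the
    integral transform, so they differ by a null set; this yields the factorisation through the
    margins. *)
Lemma copula_exists d (Omega : measurableType d) (R : realType)
    (P : probability Omega R) (X Y : Omega -> R)
    (mX : measurable_fun setT X) (mY : measurable_fun setT Y)
    (X_atomless : forall x, P [set w | X w = x] = 0%E)
    (Y_atomless : forall y, P [set w | Y w = y] = 0%E) :
  exists C, copula_of P X Y C.
Proof.
pose F := distribution_function P X; pose H := distribution_function P Y.
have mF : measurable_fun setT F.
  by apply: nondecreasing_measurable => // x y *; exact: distribution_function_nd.
have mH : measurable_fun setT H.
  by apply: nondecreasing_measurable => // x y *; exact: distribution_function_nd.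
have mFX : measurable_fun setT (F \o X) by exact: measurableT_comp.
have mHY : measurable_fun setT (H \o Y) by exact: measurableT_comp.
have mFH : measurable_fun setT (fun w => (F (X w), H (Y w))) by exact: measurable_fun_pair.
pose Q : probability (R * R)%type R := distribution P (mfun_Sub (mem_set mFH)).
have mle (Z : Omega -> R) u : measurable_fun setT Z -> measurable [set w | Z w <= u].
  move=> mZ; have mb : measurable_fun setT (fun w => Z w <= u) by exact: measurable_fun_ler.
  by have := mb measurableT [set true] I; rewrite setTI.
have uniform (Z : Omega -> R) (mZ : measurable_fun setT Z)
    (mFZ : measurable_fun setT (distribution_function P Z \o Z)) :
    (forall x, P [set w | Z w = x] = 0%E) -> forall A, measurable A ->
    P ((distribution_function P Z \o Z) @^-1` A) = uniform_prob (@ltr01 R) A.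
  move=> Z0 A mA.
  pose S : probability R R := distribution P (mfun_Sub (mem_set mFZ)).
  have := @uniform_law_unique _ S; apply => // v v01.
  rewrite -(probability_integral_transform mZ Z0 v01).
  have E : (distribution_function P Z \o Z) @^-1` `]-oo, v] =
      [set w | distribution_function P Z (Z w) <= v].
    by apply/seteqP; split => w /=; rewrite in_itv.
  by rewrite -E.
exists (fun u v => fine (Q [set x | x.1 <= u /\ x.2 <= v])); split.
  exists Q; split.
  - by move=> A mA; exact: (uniform X mX mFX).
  - by move=> A mA; exact: (uniform Y mY mHY).
  - by [].
move=> x y; rewrite /joint_distribution_function; congr fine.
pose A := [set w | X w <= x]; pose B := [set w | Y w <= y].
pose A' := [set w | F (X w) <= F x]; pose B' := [set w | H (Y w) <= H y].
have [mA mB] : measurable A /\ measurable B by split; exact: mle.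
have mA' : measurable A' by exact: (mle (F \o X)).
have mB' : measurable B' by exact: (mle (H \o Y)).
have AA' : A `<=` A' by move=> w; exact: distribution_function_nd.
have BB' : B `<=` B' by move=> w; exact: distribution_function_nd.
have A'A0 : P (A' `\` A) = 0%E.
  rewrite measureD// ?ltey_eq ?fin_num_measure//.
  have PA' : P A' = P A.
    rewrite -[RHS]distribution_functionE//.
    apply: (probability_integral_transform mX X_atomless (v := F x)) => //.
    by apply/andP; split; [exact: distribution_function_ge0|exact: distribution_function_le1].
  by rewrite setIidr// [X in (X - _)%E]PA' subee// fin_num_measure.
have B'B0 : P (B' `\` B) = 0%E.
  rewrite measureD// ?ltey_eq ?fin_num_measure//.
  have PB' : P B' = P B.
    rewrite -[RHS]distribution_functionE//.
    apply: (probability_integral_transform mY Y_atomless (v := H y)) => //.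
    by apply/andP; split; [exact: distribution_function_ge0|exact: distribution_function_le1].
  by rewrite setIidr// [X in (X - _)%E]PB' subee// fin_num_measure.
change (P (A `&` B) = P (A' `&` B')).
apply/eqP; rewrite eq_le le_measure ?inE//=; [|exact: measurableI|exact: measurableI|exact: setISS].
apply: (@le_trans _ _ (P ((A `&` B) `|` ((A' `\` A) `|` (B' `\` B))))).
  rewrite le_measure ?inE//.
  - exact: measurableI.
  - by apply: measurableU; [exact: measurableI|apply: measurableU; exact: measurableD].
  - move=> w [A'w B'w]; have [Aw|nA] := pselect (A w); last by right; left.
    by have [Bw|nB] := pselect (B w); [left|right; right].
have P0 : P ((A' `\` A) `|` (B' `\` B)) = 0%E.
  by apply: null_set_setU => //; exact: measurableD.
apply: le_trans (measureU2 _ _ _) _.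
- exact: measurableI.
- by apply: measurableU; exact: measurableD.
- by rewrite [X in (_ + X)%E]P0 adde0.
Qed.

(** * The copula of the terminal value and the maximum *)

Lemma probability_bool_ae_eq d (T : measurableType d) (R : realType) (P : probability T R)
    (b b' : T -> bool) : measurable_fun setT b -> measurable_fun setT b' ->
  {ae P, forall x, b x = b' x} -> P [set x | b x] = P [set x | b' x].
Proof.
move=> mb mb' bb'; rewrite -!probability_bool//.
apply: ge0_ae_eq_integral => //.
- by apply/measurable_EFinP; exact: measurable_fun_indic_bool.
- by apply/measurable_EFinP; exact: measurable_fun_indic_bool.
- by apply: filterS bb' => x -> _.
Qed.

Lemma probability_bool_cvg d (T : measurableType d) (R : realType) (P : probability T R)
    (b : nat -> T -> bool) (b' : T -> bool) :
  (forall n, measurable_fun setT (b n)) -> measurable_fun setT b' ->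
  {ae P, forall x, \forall n \near \oo, b n x = b' x} ->
  P [set x | b n x] @[n --> \oo] --> P [set x | b' x].
Proof.
move=> mb mb' cb; rewrite -probability_bool//.
under eq_fun do rewrite -probability_bool//.
pose f n (x : T) : \bar R := (b n x)%:R%:E.
pose g (x : T) : \bar R := (b' x)%:R%:E.
have [_ _] : [/\ P.-integrable setT g, (\int[P]_x `|f n x - g x| @[n --> \oo] --> 0)%E &
    (\int[P]_x f n x @[n --> \oo] --> \int[P]_x g x)%E].
  apply: (@dominated_convergence _ _ _ P setT measurableT f g (cst 1%:E)) => //.
  - by move=> n; apply/measurable_EFinP; exact: measurable_fun_indic_bool.
  - by apply/measurable_EFinP; exact: measurable_fun_indic_bool.
  - apply: filterS cb => x cb _; apply: cvg_near_cst.
    by apply: filterS cb => n E; rewrite /f /g E.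
  - exact: finite_measure_integrable_cst.
  - apply: aeW => x n _ /=; rewrite lee_fin ger0_norm//.
    by case: (b n x); rewrite ?lexx ?ler01.
by [].
Qed.

Lemma le_cvg_near (R : realType) (a : nat -> R) (l c : R) :
  a n @[n --> \oo] --> l -> c != l -> \forall n \near \oo, (c <= a n) = (c <= l).
Proof.
move=> al; rewrite neq_lt => /orP[cl|lc].
  have : \forall n \near \oo, c < a n by exact: (cvgr_gt _ al).
  by apply: filterS => n can; rewrite !ltW.
have : \forall n \near \oo, a n < c by exact: (cvgr_lt _ al).
by apply: filterS => n anc; rewrite !leNgt anc lc.
Qed.

Section terminal_and_maximum.
Context d (Omega : measurableType d) (R : realType) (P : probability Omega R).
Context (W1 W2 : R -> {RV P >-> R}) (hW1 : standard_brownian_motion W1)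
  (hW2 : standard_brownian_motion W2) (hW : independent_processes W1 W2).
Context (mu rho s t T : R) (hs : 0 < s) (hst : s < t) (htT : t <= T)
  (hrho : rho ^+ 2 <= 1).
Notation sigma := (Num.sqrt (1 - rho ^+ 2)).
Notation G := (residual W1 W2 rho sigma t T).
Notation X := (drifted W2 mu).
Notation M := (running_max X s t).
Notation A := (fun w => rho * (X t w - mu * t) + G w).

Let t0 : 0 < t := lt_trans hs hst.

Let T0 : 0 < T := lt_le_trans t0 htT.

Let mG : measurable_fun setT G. Proof. exact: measurable_residual. Qed.

Let mX r : measurable_fun setT (X r). Proof. exact: measurable_drifted. Qed.

Let cX w : {within `[s, t], continuous (X ^~ w)}. Proof. exact: drifted_continuous. Qed.

Let mM : measurable_fun setT M.
Proof. exact: measurable_running_max hst (@cX) mX. Qed.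

Let sigma2 : sigma ^+ 2 = 1 - rho ^+ 2.
Proof. by rewrite sqr_sqrtr ?subr_ge0. Qed.

Let terminalE w : A w = rho * (W2 s w - W2 0 w) + rho * (W2 t w - W2 s w) + 1 * G w.
Proof. by rewrite /drifted; ring. Qed.

Let terminal_variance : rho ^+ 2 * s + rho ^+ 2 * (t - s) +
  1 ^+ 2 * (sigma ^+ 2 * T + rho ^+ 2 * (T - t)) = T.
Proof. by rewrite sigma2; ring. Qed.

Lemma terminal_neq x : {ae P, forall w, A w != x}.
Proof.
have := linear_neq_ae hW1 hW2 hW (rho := rho) (sigma := sigma) hs hst htT x
  (a := rho) (b := rho) (c := 1).
rewrite terminal_variance => /(_ T0).
by apply: filterS => w; rewrite -terminalE.
Qed.

Let past_neq r x : (r = s) \/ (r = t) -> {ae P, forall w, W2 r w - W2 0 w != x}.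
Proof.
have L := linear_neq_ae hW1 hW2 hW (rho := rho) (sigma := sigma) hs hst htT x.
case=> ->.
  have := L 1 0 0; rewrite expr0n/= !mul0r !addr0 expr1n mul1r => /(_ hs).
  by apply: filterS => w; rewrite mul1r !mul0r !addr0.
have := L 1 1 0; rewrite expr0n/= mul0r addr0 expr1n !mul1r addrC subrK => /(_ t0).
by apply: filterS => w; rewrite !mul1r mul0r addr0 addrC addrA subrK.
Qed.

Lemma terminal_law x : P [set w | A w <= x] = (Phi (x / Num.sqrt T))%:E.
Proof.
have mA : measurable_fun setT A by meas.
have mle : measurable_fun setT (fun w => A w <= x) by exact: measurable_fun_ler.
rewrite -(probability_bool P mle).
pose f (y : R) : \bar R := ((y <= x)%R%:R : R)%:E.
have mf : measurable_fun setT f.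
  by apply/measurable_EFinP; apply: measurable_fun_indic_bool; meas.
have f0 y : (0 <= f y)%E by rewrite lee_fin.
transitivity (\int[P]_w f (rho * (W2 s w - W2 0 w) + rho * (W2 t w - W2 s w) + 1 * G w)%R)%E.
  by apply: eq_integral => w _; rewrite terminalE.
rewrite (ge0_integral_linear hW1 hW2 hW) // terminal_variance.
rewrite (probability_bool (@gauss R) (b := fun y => Num.sqrt T * y <= x)); last first.
  by apply: measurable_fun_ler; meas.
have -> : [set y | Num.sqrt T * y <= x] = `]-oo, x / Num.sqrt T]%classic.
  by apply/seteqP; split => y /=; rewrite in_itv/= ler_pdivlMr ?sqrtr_gt0// mulrC.
by rewrite /Phi fineK// (@fin_num_measure _ _ _ (@gauss R)).
Qed.

Let mset (b : Omega -> bool) : measurable_fun setT b -> measurable [set w | b w].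
Proof. by move=> mb; have := mb measurableT [set true] I; rewrite setTI. Qed.

(** The law of [M] is not known beforehand to be continuous, so the limit is taken on the right-hand
    side of [joint_law_events], whose events involve only atomless Gaussian variables. *)
Lemma joint_law_cvg x y (z : nat -> R) : z n @[n --> \oo] --> y ->
  P [set w | (A w <= x) && (M w <= z n)] @[n --> \oo] -->
  P [set w | (A w <= x) && (M w <= y)].
Proof.
move=> zy; rewrite joint_law_events//.
under eq_fun do rewrite joint_law_events//.
have zD c : z n + c @[n --> \oo] --> y + c by apply: cvgD => //; exact: cvg_cst.
have zN c : - z n + c @[n --> \oo] --> - y + c.
  by apply: cvgD; [exact: cvgN|exact: cvg_cst].
have mE e a b c : measurable_fun setT (fun w =>
    [&& rho * (W2 t w - W2 0 w) + G w <= a, W2 t w - W2 0 w <= b &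
        e * (W2 s w - W2 0 w) <= c]) by meas.
apply: cvgeB.
- by rewrite fin_num_adde_defr// fin_num_measure//; exact: mset.
- apply: probability_bool_cvg => [n||]; [exact: mE|exact: mE|].
  have := past_neq (y - mu * s) (or_introl erefl).
  have := past_neq (y - mu * t) (or_intror erefl).
  apply: filterS2 => w nt ns.
  have := le_cvg_near (zD (- (mu * t))) nt; have := le_cvg_near (zD (- (mu * s))) ns.
  by apply: filterS2 => n; rewrite mul1r => -> ->.
- apply: cvgeM.
  + by rewrite mule_def_fin// fin_num_measure//; exact: mset.
  + apply: cvg_EFin; first exact: nearW.
    apply: continuous_cvg; first exact: continuous_expR.
    by apply: cvgM => //; exact: cvg_cst.
  + apply: probability_bool_cvg => [n||]; [exact: mE|exact: mE|].
    have nA : {ae P, forall w, rho * (W2 t w - W2 0 w) + G w != x - 2 * rho * y}.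
      by have := terminal_neq (x - 2 * rho * y); apply: filterS => w; rewrite /drifted addrK.
    have := past_neq (- (y + mu * s)) (or_introl erefl).
    have := past_neq (- y - mu * t) (or_intror erefl).
    move: nA; apply: filterS3 => w na nt ns.
    have xz : x - 2 * rho * z n @[n --> \oo] --> x - 2 * rho * y.
      by apply: cvgB; [exact: cvg_cst|apply: cvgM => //; exact: cvg_cst].
    have ns' : -1 * (W2 s w - W2 0 w) != y + mu * s by rewrite mulN1r eqr_oppLR.
    have := le_cvg_near xz na; have := le_cvg_near (zN (- (mu * t))) nt.
    have := le_cvg_near (zD (mu * s)) ns'.
    by apply: filterS3 => n -> -> ->.
Qed.

(** For fixed [x], an atom at [y] on [A <= x] is bounded by the increments of the joint law between
    [y - n.+1%:R^-1] and [y], which tend to 0; letting [x] run through the integers removes the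
    constraint on [A]. *)
Lemma maximum_neq y : {ae P, forall w, M w != y}.
Proof.
pose z n : R := y - n.+1%:R^-1.
have zy : z n @[n --> \oo] --> y.
  rewrite -[X in _ --> X]subr0; apply: cvgB; first exact: cvg_cst.
  exact: cvg_harmonic.
have mA : measurable_fun setT A by meas.
pose J x v := P [set w | (A w <= x) && (M w <= v)].
have mJ x v : measurable [set w | (A w <= x) && (M w <= v)] by apply: mset; meas.
have Jfin x v : J x v \is a fin_num by rewrite fin_num_measure.
have mEq x : measurable [set w | (A w <= x) && (M w == y)].
  by apply: mset; apply: measurable_and; [meas|apply: measurable_fun_eqr; meas].
have E0 x : P [set w | (A w <= x) && (M w == y)] = 0%E.
  set p := P _; have step n : (p <= J x y - J x (z n))%E.
    have lt_zy : z n < y by rewrite ltrBlDr ltrDl invr_gt0.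
    have dis : [set w | (A w <= x) && (M w == y)] `&`
        [set w | (A w <= x) && (M w <= z n)] = set0.
      by apply/seteqP; split => // w /= [/andP[_ /eqP ->] /andP[_]]; rewrite leNgt lt_zy.
    rewrite leeBrDr// -[leLHS](measureU P (mEq x) (mJ x (z n)) dis).
    rewrite le_measure ?inE//; first exact: measurableU.
    by move=> w /= [] /andP[-> /=]; [move=> /eqP ->|move=> /le_trans; apply; exact: ltW].
  have cv : (J x y - J x (z n) @[n --> \oo] --> 0)%E.
    rewrite -[X in _ --> X](subee (Jfin x y)); apply: cvgeB.
    - by rewrite fin_num_adde_defr.
    - exact: cvg_cst.
    - exact: joint_law_cvg.
  apply/eqP; rewrite eq_le measure_ge0 andbT.
  by apply: (cvge_ge _ cv); apply: nearW => n; exact: step.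
have null : P.-negligible (\bigcup_n [set w | (A w <= n%:R) && (M w == y)]).
  by apply: negligible_bigcup => n; exists [set w | (A w <= n%:R) && (M w == y)]; split;
    [exact: mEq|exact: E0|].
apply: negligibleS null => w /= /negP; rewrite negbK => My.
by exists (Num.truncn `|A w|).+1 => //=; rewrite My andbT (le_trans (ler_norm _))// ltW// truncnS_gt.
Qed.

End terminal_and_maximum.

Lemma gauss_quantile (R : realType) (u : R) : 0 < u < 1 -> Phi (quantile (@Phi R) u) = u.
Proof.
have mid : measurable_fun setT (id : measurableTypeR R -> R) by exact: measurable_id.
have atom (x : R) : @gauss R [set y | id y = x] = 0%E by exact: gauss_set1.
have PhiE : @Phi R = distribution_function (@gauss R) id.
  apply/funext => x; rewrite /Phi /distribution_function.
  have -> : `]-oo, x]%classic = [set y : R | id y <= x].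
    by apply/seteqP; split => y /=; rewrite in_itv.
  by [].
by rewrite PhiE; exact: (distribution_quantile (P := @gauss R) mid atom).
Qed.

Section copula.
Context d (Omega : measurableType d) (R : realType) (P : probability Omega R).
Context (W1 W2 : R -> {RV P >-> R}) (hW1 : standard_brownian_motion W1)
  (hW2 : standard_brownian_motion W2) (hW : independent_processes W1 W2).
Context (mu rho s t T : R) (hs : 0 < s) (hst : s < t) (htT : t <= T)
  (hrho : rho ^+ 2 <= 1).
Notation sigma := (Num.sqrt (1 - rho ^+ 2)).
Notation X := (drifted W2 mu).
Notation M := (running_max X s t).
Notation A := (fun w => rho * (X t w - mu * t) + residual W1 W2 rho sigma t T w).
Notation B1T := (B1 rho W1 W2 T).
Notation M2 := (running_max (B2 mu W2) s t).

Let t0 : 0 < t := lt_trans hs hst.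

Let T0 : 0 < T := lt_le_trans t0 htT.

(** Transfers the results on processes with subtracted starting value back to [B1] and [B2]. *)
Let started_at_0 : {ae P, forall w, B1T w = A w /\ M2 w = M w}.
Proof.
have [+ _ _ _] := hW2; apply: filterS => w W0; split.
  by rewrite /B1 /drifted /residual W0; ring.
rewrite /running_max; congr sup; apply: eq_imagel => r _.
by rewrite /B2 /drifted W0 subr0.
Qed.

Lemma measurable_terminal : measurable_fun setT B1T.
Proof. by rewrite /B1; meas. Qed.

Lemma measurable_maximum : measurable_fun setT M2.
Proof.
apply: (measurable_running_max hst) => [w|r]; last first.
  by apply: measurable_funD => //; exact: measurable_cst.
have cX : {within `[s, t], continuous (X^~ w)} by exact: drifted_continuous.
have E : (B2 mu W2)^~ w = (fun r => X r w + W2 0 w).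
  by apply/funext => r; rewrite /B2 /drifted; ring.
rewrite E => r; apply: cvgD; [exact: cX|exact: cvg_cst].
Qed.

Let mB := measurable_terminal.
Let mM2 := measurable_maximum.

Let mA : measurable_fun setT A.
Proof.
have mG : measurable_fun setT (residual W1 W2 rho sigma t T) by exact: measurable_residual.
have mX : measurable_fun setT (X t) by exact: measurable_drifted.
by meas.
Qed.

Let mM : measurable_fun setT M.
Proof.
apply: (measurable_running_max hst) => [w|r]; last exact: measurable_drifted.
exact: drifted_continuous.
Qed.

Lemma distribution_terminal x : distribution_function P B1T x = Phi (x / Num.sqrt T).
Proof.
rewrite /distribution_function.
rewrite (@probability_bool_ae_eq _ _ _ P (fun w => B1T w <= x) (fun w => A w <= x)).
- by rewrite (terminal_law hW1 hW2 hW mu hs hst htT hrho).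
- by apply: measurable_fun_ler; [exact: mB|exact: measurable_cst].
- by apply: measurable_fun_ler; [exact: mA|exact: measurable_cst].
- by apply: filterS started_at_0 => w [-> _].
Qed.

Lemma joint_distribution_terminal_maximum x y : joint_distribution_function P B1T M2 x y =
  Phi3 (x / Num.sqrt T) ((y - mu * t) / Num.sqrt t) ((y - mu * s) / Num.sqrt s)
     (rho * Num.sqrt (t / T)) (rho * Num.sqrt (s / T)) (Num.sqrt (s / t))
   - expR (2 * mu * y) *
     Phi3 ((x - 2 * rho * y) / Num.sqrt T) ((- y - mu * t) / Num.sqrt t)
       ((y + mu * s) / Num.sqrt s)
       (rho * Num.sqrt (t / T)) (- (rho * Num.sqrt (s / T))) (- Num.sqrt (s / t)).
Proof.
rewrite /joint_distribution_function.
have -> : [set w | B1T w <= x /\ M2 w <= y] = [set w | (B1T w <= x) && (M2 w <= y)].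
  by apply/seteqP; split => w /= /andP.
have mand (F H : Omega -> R) : measurable_fun setT F -> measurable_fun setT H ->
    measurable_fun setT (fun w => (F w <= x) && (H w <= y)).
  by move=> mF mH; apply: measurable_and; apply: measurable_fun_ler => //;
    exact: measurable_cst.
rewrite (@probability_bool_ae_eq _ _ _ P _ (fun w => (A w <= x) && (M w <= y))).
- by rewrite (joint_law hW1 hW2 hW mu hs hst htT hrho).
- exact: mand.
- exact: mand.
- by apply: filterS started_at_0 => w [-> ->].
Qed.

Lemma terminal_atomless x : P [set w | B1T w = x] = 0%E.
Proof.
have mE : measurable [set w | B1T w = x].
  rewrite (_ : mkset _ = B1T @^-1` [set x])// -[X in measurable X]setTI.
  by apply: mB => //; exact: measurable_set1.
apply: measure_negligible => //.
have ne : {ae P, forall w, B1T w != x}.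
  have := terminal_neq hW1 hW2 hW mu hs hst htT hrho x.
  by apply: filterS2 started_at_0 => w [-> _].
by apply: negligibleS ne => w /= ->; rewrite eqxx.
Qed.

Lemma maximum_atomless y : P [set w | M2 w = y] = 0%E.
Proof.
have mE : measurable [set w | M2 w = y].
  rewrite (_ : mkset _ = M2 @^-1` [set y])// -[X in measurable X]setTI.
  by apply: mM2 => //; exact: measurable_set1.
apply: measure_negligible => //.
have ne : {ae P, forall w, M2 w != y}.
  have := maximum_neq hW1 hW2 hW mu hs hst htT hrho y.
  by apply: filterS2 started_at_0 => w [_ ->].
by apply: negligibleS ne => w /= ->; rewrite eqxx.
Qed.

End copula.

Theorem mainTheorem5 (R : realType) (d : measure_display)
    (Omega : measurableType d) (P : probability Omega R)
    (W1 W2 : R -> {RV P >-> R}) (mu rho s t T : R)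
    (hW1 : standard_brownian_motion W1)
    (hW2 : standard_brownian_motion W2)
    (hW : independent_processes W1 W2)
    (hrho : -1 <= rho <= 1) (hs : 0 < s) (hst : s < t) (htT : t <= T) :
  let B1T := B1 rho W1 W2 T in
  let M2 := running_max (B2 mu W2) s t in
  let zeta := quantile (distribution_function P M2) in
  (exists C : R -> R -> R, copula_of P B1T M2 C) /\
  forall C : R -> R -> R, copula_of P B1T M2 C ->
  forall u v : R, 0 < u < 1 -> 0 < v < 1 ->
    C u v =
      Phi3 (quantile (@Phi R) u)
           ((zeta v - mu * t) / Num.sqrt t)
           ((zeta v - mu * s) / Num.sqrt s)
           (rho * Num.sqrt (t / T)) (rho * Num.sqrt (s / T)) (Num.sqrt (s / t))
      - expR (2 * mu * zeta v) *
        Phi3 (quantile (@Phi R) u - 2 * rho * zeta v / Num.sqrt T)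
             ((- zeta v - mu * t) / Num.sqrt t)
             ((zeta v + mu * s) / Num.sqrt s)
             (rho * Num.sqrt (t / T)) (- (rho * Num.sqrt (s / T)))
             (- Num.sqrt (s / t)).
Proof.
move=> B1T M2 zeta.
have hrho2 : rho ^+ 2 <= 1.
  case/andP: hrho => rho1 rho2; have : 0 <= (1 - rho) * (1 + rho) by rewrite mulr_ge0; lra.
  by rewrite (_ : (1 - rho) * (1 + rho) = 1 - rho ^+ 2) ?subr_ge0//; ring.
have T0 : 0 < T := lt_le_trans (lt_trans hs hst) htT.
have rT0 : Num.sqrt T != 0 by rewrite gt_eqF// sqrtr_gt0.
have mB : measurable_fun setT B1T by exact: measurable_terminal.
have mM : measurable_fun setT M2 by exact: measurable_maximum.
have aB := terminal_atomless hW1 hW2 hW mu hs hst htT hrho2.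
have aM := maximum_atomless hW1 hW2 hW mu hs hst htT hrho2.
split; first exact: copula_exists.
move=> C [_ jointE] u v u01 v01.
set q := quantile (@Phi R) u.
have qK : q * Num.sqrt T / Num.sqrt T = q by rewrite mulfK.
have qBK : (q * Num.sqrt T - 2 * rho * zeta v) / Num.sqrt T =
    q - 2 * rho * zeta v / Num.sqrt T by rewrite mulrBl qK.
(* The terminal value has standard deviation [Num.sqrt T], so its level [u] is reached at
   [q * Num.sqrt T]. At this point and at [zeta v] the margins are exactly [u] and [v], and the
   copula identity becomes the joint law. *)
have uE : distribution_function P B1T (q * Num.sqrt T) = u.
  by rewrite (distribution_terminal hW1 hW2 hW mu hs hst htT hrho2) qK gauss_quantile.
have vE : distribution_function P M2 (zeta v) = v by exact (distribution_quantile mM aM v01).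
rewrite -[in LHS]uE -[in LHS]vE -jointE.
by rewrite (joint_distribution_terminal_maximum hW1 hW2 hW mu hs hst htT hrho2) qK qBK.
Qed.
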